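(* There is an increasing sequence of real numbers $(\sigma_n)_{n\ge0}$ with $\sigma_0=1$ and $\sigma_1=\gamma=(1+\sqrt5)/2$, converging to a real number $\sigma_\infty$, such that $\sigma_\infty$ is the smallest accumulation point of $\mathcal{D}_0$ and $\mathcal{D}_0\cap[1,\sigma_\infty)=\{\sigma_n : n\ge0\}$; the same statement holds with $\mathcal{D}$ in place of $\mathcal{D}_0$. Moreover $\sigma_2 = 1+\sqrt2/2=[1;1,\overline{2}]$ and $\sigma_3=(2+\sqrt{10})/3=[1;1,\overline{2,1,1}]$.
   Context: Alphabets are arbitrary sets; infinite words are right-infinite; the empty word counts as a palindromic prefix. For an infinite word $w$ with infinitely many palindromic prefixes, let $(n_i)_{i\ge1}$ be the increasing sequence of lengths of all its palindromic prefixes ($n_1=0$) and $\delta(w)=\limsup n_{i+1}/n_i$; otherwise $\delta(w)=\infty$. $w$ has abundant palindromic prefixes if it has infinitely many palindromic prefixes and $n_{i+1}\le 2n_i+1$ for all $i\ge1$. $\mathcal{D}$ is the set of all $\delta(w)$ over infinite words on arbitrary alphabets, $\mathcal{D}_0$ the set of $\delta(w)$ over words with abundant palindromic prefixes. $\overline{m}$ denotes infinite periodic repetition of the finite sequence $m$ in a continued fraction. *)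

(* Defs.v *)
From Stdlib Require Import Reals.
From Coquelicot Require Import Coquelicot.
Open Scope R_scope.

Definition pal_prefix {A : Type} (w : nat -> A) (k : nat) : Prop :=
  forall j : nat, (j < k)%nat -> w j = w (k - 1 - j)%nat.

(* n enumerates, increasingly, the lengths of ALL palindromic prefixes of w
   (n 0 = 0 is the empty prefix; paper's n_i is n (i-1)).  Such an n exists
   iff w has infinitely many palindromic prefixes, and it is then unique. *)
Definition pal_lengths {A : Type} (w : nat -> A) (n : nat -> nat) : Prop :=
  (forall i, (n i < n (S i))%nat) /\
  (forall k, pal_prefix w k <-> exists i, n i = k).

(* delta w = x (x finite real): w has infinitely many palindromic prefixes
   and limsup_i n_{i+1}/n_i = x.  (The undefined first ratio n_2/n_1 with
   n_1 = 0 is irrelevant for the limsup and is skipped.) *)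
Definition delta_is {A : Type} (w : nat -> A) (x : R) : Prop :=
  exists n, pal_lengths w n /\
    LimSup_seq (fun i => INR (n (S (S i))) / INR (n (S i))) = Finite x.

Definition abundant {A : Type} (w : nat -> A) : Prop :=
  exists n, pal_lengths w n /\ (forall i, (n (S i) <= 2 * n i + 1)%nat).

Definition in_D (x : R) : Prop :=
  exists (A : Type) (w : nat -> A), delta_is w x.
Definition in_D0 (x : R) : Prop :=
  exists (A : Type) (w : nat -> A), abundant w /\ delta_is w x.

Definition accumulation_point (S : R -> Prop) (x : R) : Prop :=
  forall eps : R, 0 < eps -> exists y, S y /\ y <> x /\ Rabs (y - x) < eps.

Definition smallest_accumulation_point (S : R -> Prop) (x : R) : Prop :=
  accumulation_point S x /\ (forall y, accumulation_point S y -> x <= y).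

Fixpoint cf_fin (a : nat -> R) (n : nat) : R :=
  match n with
  | O => a O
  | S m => a O + / cf_fin (fun i => a (S i)) m
  end.

Definition cf_value (a : nat -> R) (x : R) : Prop :=
  is_lim_seq (fun n => cf_fin a n) x.

Definition cf_sigma2 (i : nat) : R :=
  match i with O => 1 | 1%nat => 1 | _ => 2 end.
Definition cf_sigma3 (i : nat) : R :=
  match i with
  | O => 1 | 1%nat => 1
  | S (S j) => if Nat.eqb (Nat.modulo j 3) 0 then 2 else 1
  end.

(* Main.v *)
Require Import Defs.
From Stdlib Require Import Reals Lra Lia List Bool Classical.
From Coquelicot Require Import Coquelicot.
Import ListNotations.
Open Scope R_scope.

(** If [p < q] are lengths of palindromic prefixes of [w], then [q - p] is a
    period of the prefix of length [q]; hence the gaps [n_{i+1} - n_i] are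
    nondecreasing and, when the ratios [n_{i+1} / n_i] stay below 105/61, the
    successive distinct gaps [P_k] eventually satisfy
    [P_{k+1} = a_k P_k + P_{k-1}] with [a_k] in [{1, 2}], as for a Sturmian
    word, and delta = 1 + L / (1 + L) with [L = limsup [a_k; a_{k-1}, ...]].

    The limit points of [P_{k+1} / P_k] form a set [X] with maximum [L] on
    which [x = 1 + 1/y] or [x = 2 + 1/y] with [y] again in [X].  If [L] is
    below the purely periodic continued fraction of period [phi^N(1)], where
    [phi] maps 1 to 2 and 2 to 211, then maximality of [L] shows that either
    only the digit 1 occurs, or [X] is coded by the blocks 2 and 211.
    Both blocks have odd length, so [phi] preserves the alternating
    lexicographic order and the argument repeats one level down: [L] is the
    continued fraction of period [phi^j(1)] for some [j].  These values
    increase with [j] and are attained by the standard Sturmian words with the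
    corresponding periodic directive words. *)

(** * Palindromic prefixes *)

Definition prefix_period {A : Type} (w : nat -> A) (q d : nat) : Prop :=
  forall j, (j + d < q)%nat -> w j = w (j + d)%nat.

(** Composing the reflections of two palindromes with a common start gives the translation by the
    difference of their lengths. *)
Lemma pal_prefix_period {A : Type} (w : nat -> A) m q :
  pal_prefix w m -> pal_prefix w q -> (m <= q)%nat ->
  prefix_period w q (q - m).
Proof.
  intros Hm Hq Hle j Hj.
  rewrite (Hm j) by lia. rewrite (Hq (m - 1 - j)%nat) by lia.
  f_equal; lia.
Qed.

Lemma pal_prefix_sub_period {A : Type} (w : nat -> A) q d :
  pal_prefix w q -> prefix_period w q d -> pal_prefix w (q - d).
Proof.
  intros Hq Hd j Hj.
  rewrite (Hq j) by lia.
  rewrite (Hd (q - d - 1 - j)%nat) by lia. f_equal; lia.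
Qed.

Lemma prefix_period_le {A : Type} (w : nat -> A) q q' d :
  (q <= q')%nat -> prefix_period w q' d -> prefix_period w q d.
Proof. intros Hle H j Hj. apply H. lia. Qed.

(** * Standard words *)

Section StandardWord.
Local Open Scope nat_scope.
Variable d : nat -> bool.

(* [per i b] is the period of the palindromic prefix of length [len i] that is
   continued when the next letter is [b]. *)
Fixpoint per (i : nat) (b : bool) : nat :=
  match i with
  | O => 1
  | S i => if eqb b (d i) then per i b else per i b + per i (negb b)
  end.

(** The length [p + q - 2] of a central word with coprime periods [p] and [q]. *)
Definition len (i : nat) : nat := per i true + per i false - 2.

(** Iterated palindromic closure: [d i'] is appended to the palindrome of length [len i'], and later
    letters mirror earlier ones. The value at stage 0 is a default, as [len 0 = 0]. *)
Fixpoint stage (i j : nat) : bool :=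
  match i with
  | O => true
  | S i' =>
      if j <? len i' then stage i' j
      else if j =? len i' then d i'
      else stage i' (len i - 1 - j)
  end.

Definition standard_word (j : nat) : bool := stage (S j) j.

Lemma per_pos i b : 1 <= per i b.
Proof.
  revert b; induction i as [|i IH]; intros b; simpl; [lia|].
  destruct (eqb b (d i)); specialize (IH b); lia.
Qed.

Lemma len_per i b : len i + 2 = per i b + per i (negb b).
Proof.
  unfold len. pose proof (per_pos i true). pose proof (per_pos i false).
  destruct b; simpl; lia.
Qed.

Lemma per_same i : per (S i) (d i) = per i (d i).
Proof. simpl. now rewrite eqb_reflx. Qed.

Lemma per_other i :
  per (S i) (negb (d i)) = per i (negb (d i)) + per i (d i).
Proof. simpl. destruct (d i); reflexivity. Qed.

Lemma len_S i : len (S i) = len i + per i (d i).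
Proof.
  pose proof (len_per (S i) (d i)) as H. pose proof (len_per i (d i)) as H0.
  rewrite per_same, per_other in H. lia.
Qed.

Lemma per_le i b : per i b <= len i + 1.
Proof. pose proof (len_per i b). pose proof (per_pos i (negb b)). lia. Qed.

Lemma len_lt i : len i < len (S i).
Proof. rewrite len_S. pose proof (per_pos i (d i)). lia. Qed.

Lemma len_mono i j : i < j -> len i < len j.
Proof.
  induction 1 as [|j Hj IH]; [apply len_lt|]. pose proof (len_lt j). lia.
Qed.

Lemma len_mono_inv i j : len i < len j -> i < j.
Proof.
  intros H. destruct (Nat.lt_trichotomy i j) as [|[->|Hji]]; [trivial|lia|].
  apply len_mono in Hji. lia.
Qed.

Lemma len_ge i : i <= len i.
Proof. induction i as [|i IH]; [lia|]. pose proof (len_lt i). lia. Qed.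

Lemma stage_stable i i' j : i <= i' -> j < len i -> stage i' j = stage i j.
Proof.
  intros Hi Hj. induction Hi as [|i' Hi IH]; [reflexivity|].
  simpl. destruct (Nat.ltb_spec j (len i')) as [|Hge]; [exact IH|].
  enough (len i <= len i') by lia.
  destruct (Nat.eq_dec i i') as [->|]; [lia|].
  enough (len i < len i') by lia. apply len_mono; lia.
Qed.

Lemma standard_word_stage i j : j < len i -> standard_word j = stage i j.
Proof.
  intros Hj. unfold standard_word. pose proof (len_ge (S j)) as H.
  destruct (Nat.le_ge_cases (S j) i) as [Hi|Hi].
  - symmetry. apply stage_stable; lia.
  - apply stage_stable; lia.
Qed.

Lemma standard_word_len i : standard_word (len i) = d i.
Proof.
  rewrite (standard_word_stage (S i)) by apply len_lt.
  simpl. now rewrite Nat.ltb_irrefl, Nat.eqb_refl.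
Qed.

Lemma standard_word_reflect i j :
  len i < j < len (S i) ->
  standard_word j = standard_word (len (S i) - 1 - j).
Proof.
  intros Hj. rewrite (standard_word_stage (S i) j) by lia.
  pose proof (len_S i). pose proof (per_le i (d i)).
  rewrite (standard_word_stage i (len (S i) - 1 - j)) by lia.
  cbn [stage]. destruct (Nat.ltb_spec j (len i)); [lia|].
  destruct (Nat.eqb_spec j (len i)); [lia|reflexivity].
Qed.

(* [len i - per i b] is the length of the last palindromic prefix before
   [len i] that is followed by the letter [b]. *)
Lemma per_spec i b :
  (per i b = len i + 1 /\ forall j, j < i -> d j = negb b) \/
  (exists j, j < i /\ d j = b /\ len i = len j + per i b /\
     forall j', j < j' < i -> d j' = negb b).
Proof.
  induction i as [|i IH].
  - left. split; [destruct b; reflexivity|lia].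
  - destruct (bool_dec (d i) b) as [Hb|Hb].
    + right. exists i. repeat split; [lia|exact Hb| |lia].
      rewrite len_S, <- Hb, per_same. lia.
    + assert (Hd : d i = negb b) by (destruct (d i), b; simpl; congruence).
      assert (Hb' : b = negb (d i)) by (rewrite Hd; now destruct b).
      assert (Hp : per (S i) b = per i b + per i (d i))
        by (rewrite Hb' at 1 2; apply per_other).
      destruct IH as [[Hper Hj]|(j & Hj & Hdj & Hl & Hbet)].
      * left. rewrite Hp, len_S. split; [lia|].
        intros j Hji. destruct (Nat.eq_dec j i) as [->|]; [exact Hd|].
        apply Hj; lia.
      * right. exists j. rewrite Hp, len_S. repeat split; [lia|exact Hdj|lia|].
        intros j' Hj'. destruct (Nat.eq_dec j' i) as [->|]; [exact Hd|].
        apply Hbet; lia.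
Qed.

Lemma standard_word_pal i : pal_prefix standard_word (len i).
Proof.
  induction i as [i IH] using (well_founded_induction Nat.lt_wf_0).
  destruct i as [|i]; [intros j Hj; unfold len in Hj; simpl in Hj; lia|].
  assert (Hi := IH i (Nat.lt_succ_diag_r i)).
  (* A mirror image past [len i] agrees by construction. Otherwise let [k] be the last index before
     [i] with [d k = d i]: reflection in the prefix of length [len i], then a shift by its period
     [len i - len k], reaches the mirror image; at [len i] itself the letter is [d i = d k]. *)
  assert (Hlow : forall j, j < len i ->
    standard_word j = standard_word (len (S i) - 1 - j)).
  { intros j Hj. pose proof (len_S i) as HS. pose proof (per_pos i (d i)).
    pose proof (per_le i (d i)).
    destruct (Nat.lt_trichotomy (len (S i) - 1 - j) (len i)) as [Hlt|[Heq|Hgt]].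
    - rewrite (Hi j Hj).
      destruct (per_spec i (d i)) as [[Hper _]|(k & Hk & _ & Hl & _)]; [lia|].
      assert (Hp := pal_prefix_period _ (len k) (len i) (IH k ltac:(lia)) Hi
                      ltac:(lia)).
      rewrite (Hp (len i - 1 - j)) by lia. f_equal; lia.
    - rewrite Heq, standard_word_len, (Hi j Hj).
      destruct (per_spec i (d i)) as [[Hper _]|(k & Hk & Hdk & Hl & _)]; [lia|].
      replace (len i - 1 - j) with (len k) by lia.
      now rewrite standard_word_len.
    - rewrite (standard_word_reflect i (len (S i) - 1 - j)) by lia.
      f_equal; lia. }
  intros j Hj. pose proof (len_S i) as HS. pose proof (per_le i (d i)).
  destruct (Nat.lt_trichotomy j (len i)) as [Hlt|[Heq|Hgt]].
  - now apply Hlow.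
  - destruct (Nat.eq_dec (len (S i) - 1 - j) j) as [->|]; [reflexivity|].
    rewrite (Hlow (len (S i) - 1 - j)) by lia. f_equal; lia.
  - apply standard_word_reflect; lia.
Qed.

Lemma len_bracket k : exists i, len i <= k < len (S i).
Proof.
  induction k as [|k (i & Hi)].
  - exists 0. pose proof (len_lt 0). unfold len at 1. simpl. lia.
  - destruct (Nat.eq_dec (len (S i)) (S k)) as [He|He].
    + exists (S i). pose proof (len_lt (S i)). lia.
    + exists i. lia.
Qed.

(** A palindromic prefix strictly between [len i] and [len (S i)] yields by periodicity a shorter
    one, which by induction is some [len j], followed by the letter [d i]. Since [k - len i] is less
    than [per i (d i)], this [j] comes after the last earlier occurrence of [d i]. *)
Lemma standard_word_pal_inv k :
  pal_prefix standard_word k -> exists i, len i = k.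
Proof.
  induction k as [k IH] using (well_founded_induction Nat.lt_wf_0). intros Hk.
  destruct (len_bracket k) as (i & Hle & Hlt).
  destruct (Nat.eq_dec (len i) k) as [He|Hne]; [now exists i|exfalso].
  pose proof (len_S i) as HS. pose proof (per_le i (d i)).
  assert (Hi := standard_word_pal i).
  assert (Hp := pal_prefix_period _ _ _ Hi Hk Hle).
  assert (Hq := pal_prefix_sub_period _ _ _ Hi
                  (prefix_period_le _ _ _ _ Hle Hp)).
  destruct (IH (len i - (k - len i)) ltac:(lia) Hq) as (j & Hj).
  assert (Hji : j < i) by (apply len_mono_inv; lia).
  assert (Hd : d j = d i).
  { rewrite <- !standard_word_len, (Hp (len j)) by lia. f_equal; lia. }
  destruct (per_spec i (d i)) as [[_ Hno]|(j0 & _ & _ & Hl & Hbet)].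
  { rewrite (Hno j Hji) in Hd. destruct (d i); discriminate. }
  rewrite Hbet in Hd; [destruct (d i); discriminate|].
  split; [apply len_mono_inv; lia|exact Hji].
Qed.

Lemma standard_word_pal_lengths : pal_lengths standard_word len.
Proof.
  split; [exact len_lt|]. intros k; split; [apply standard_word_pal_inv|].
  intros (i & <-). apply standard_word_pal.
Qed.

Lemma standard_word_abundant : abundant standard_word.
Proof.
  exists len. split; [exact standard_word_pal_lengths|].
  intros i. rewrite len_S. pose proof (per_le i (d i)). lia.
Qed.

End StandardWord.

(** * Renormalisation of two-map codings *)

(** The properties of [1 + 1/x] and [2 + 1/x] that survive renormalisation. Decreasing maps with
    separated images turn the order of points into the alternating lexicographic order of their
    digits. *)
Record coding (I : R -> Prop) (f1 f2 : R -> R) : Prop := {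
  coding_stab1 : forall x, I x -> I (f1 x);
  coding_stab2 : forall x, I x -> I (f2 x);
  coding_decr1 : forall x y, I x -> I y -> x < y -> f1 y < f1 x;
  coding_decr2 : forall x y, I x -> I y -> x < y -> f2 y < f2 x;
  coding_sep : forall x y, I x -> I y -> f1 x < f2 y;
  coding_contr1 : forall x y, I x -> I y ->
    Rabs (f1 x - f1 y) <= 9 / 16 * Rabs (x - y);
  coding_contr2 : forall x y, I x -> I y ->
    Rabs (f2 x - f2 y) <= 9 / 16 * Rabs (x - y);
  coding_bound : forall x, I x -> 0 <= x <= 3 }.

Definition image (f : R -> R) (I : R -> Prop) (z : R) : Prop :=
  exists x, I x /\ z = f x.

Definition block211 (f1 f2 : R -> R) (x : R) : R := f2 (f1 (f1 x)).

Section Coding.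
Context {I : R -> Prop} {f1 f2 : R -> R} (HC : coding I f1 f2).

Lemma image_sub z : image f2 I z -> I z.
Proof. intros (x & Hx & ->). now apply (coding_stab2 _ _ _ HC). Qed.

Lemma block211_stab x :
  I x -> I (f1 x) /\ I (f1 (f1 x)) /\ I (block211 f1 f2 x).
Proof.
  intros Hx. assert (H1 := coding_stab1 _ _ _ HC _ Hx).
  assert (H2 := coding_stab1 _ _ _ HC _ H1).
  repeat split; [exact H1|exact H2|exact (coding_stab2 _ _ _ HC _ H2)].
Qed.

(** Both blocks consist of an odd number of decreasing maps. Separation is why the domain shrinks to
    the image of [f2]: its points exceed every [f1 (f1 y)], and [f2] reverses the order. *)
Lemma renorm_coding : coding (image f2 I) f2 (block211 f1 f2).
Proof.
  pose proof image_sub as Hsub. pose proof block211_stab as HB.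
  split.
  - intros x Hx. exists x. auto.
  - intros x Hx. exists (f1 (f1 x)). split; [|reflexivity]. apply HB; auto.
  - intros x y Hx Hy. apply (coding_decr2 _ _ _ HC); auto.
  - intros x y Hx Hy Hxy. apply Hsub in Hx, Hy.
    destruct (HB x Hx) as (? & ? & ?). destruct (HB y Hy) as (? & ? & ?).
    apply (coding_decr2 _ _ _ HC); auto. apply (coding_decr1 _ _ _ HC); auto.
    apply (coding_decr1 _ _ _ HC); auto.
  - intros x y Hx Hy. destruct (HB y (Hsub y Hy)) as (? & ? & ?).
    apply (coding_decr2 _ _ _ HC); auto.
    destruct Hx as (x' & Hx' & ->). apply (coding_sep _ _ _ HC); auto.
  - intros x y Hx Hy. apply (coding_contr2 _ _ _ HC); auto.
  - intros x y Hx Hy. apply Hsub in Hx, Hy.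
    destruct (HB x Hx) as (? & ? & ?). destruct (HB y Hy) as (? & ? & ?).
    assert (H5 := coding_contr1 _ _ _ HC x y Hx Hy).
    assert (H6 := coding_contr1 _ _ _ HC (f1 x) (f1 y) ltac:(auto) ltac:(auto)).
    assert (H7 := coding_contr2 _ _ _ HC (f1 (f1 x)) (f1 (f1 y))
                    ltac:(auto) ltac:(auto)).
    unfold block211. pose proof (Rabs_pos (x - y)). lra.
  - intros x Hx. apply (coding_bound _ _ _ HC); auto.
Qed.

End Coding.

(* Words over the digits 1 and 2, encoded as [false] and [true]. *)
Fixpoint wcomp (f1 f2 : R -> R) (W : list bool) (x : R) : R :=
  match W with
  | [] => x
  | b :: W => if b then f2 (wcomp f1 f2 W x) else f1 (wcomp f1 f2 W x)
  end.

Definition phi (W : list bool) : list bool :=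
  flat_map (fun b : bool => if b then [true; false; false] else [true]) W.

Fixpoint pword (n : nat) : list bool :=
  match n with O => [false] | S n => phi (pword n) end.

Lemma wcomp_phi f1 f2 W x :
  wcomp f1 f2 (phi W) x = wcomp f2 (block211 f1 f2) W x.
Proof.
  induction W as [|[] W IH]; [reflexivity| |]; simpl; rewrite <- IH;
  reflexivity.
Qed.

Lemma pword_cons n : exists b W, pword n = b :: W.
Proof.
  induction n as [|n (b & W & E)]; simpl; [now exists false, []|].
  rewrite E. destruct b; simpl; eauto.
Qed.

Lemma wcomp_stab (I : R -> Prop) f1 f2 W x :
  (forall x, I x -> I (f1 x)) -> (forall x, I x -> I (f2 x)) ->
  I x -> I (wcomp f1 f2 W x).
Proof. intros H1 H2 Hx. induction W as [|[] W IH]; simpl; auto. Qed.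

Lemma wcomp_pword_image (I : R -> Prop) f1 f2 n x :
  (forall x, I x -> I (f1 x)) -> (forall x, I x -> I (f2 x)) -> I x ->
  image f1 I (wcomp f1 f2 (pword n) x) \/ image f2 I (wcomp f1 f2 (pword n) x).
Proof.
  intros H1 H2 Hx. destruct (pword_cons n) as (b & W & ->).
  assert (H := wcomp_stab I f1 f2 W x H1 H2 Hx).
  destruct b; [right|left]; eexists; split; eauto.
Qed.

(** Both blocks used by [phi] begin with the digit 2, so the fixed point belongs to the domain of
    the renormalised coding. *)
Lemma fixed_point_image I f1 f2 n P :
  coding I f1 f2 -> I P -> wcomp f1 f2 (pword (S n)) P = P -> image f2 I P.
Proof.
  intros HC HP E. simpl in E. rewrite wcomp_phi in E. rewrite <- E.
  destruct (wcomp_pword_image I f2 (block211 f1 f2) n P) as [H|(y & Hy & ->)].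
  - apply (coding_stab2 _ _ _ HC).
  - intros x Hx. now apply (block211_stab HC).
  - exact HP.
  - exact H.
  - exists (f1 (f1 y)). split; [|reflexivity]. now apply (block211_stab HC).
Qed.

(** Each renormalisation removes one [phi] from both words; at the bottom a fixed point of [f1] is
    compared with one of [f2]. *)
Lemma fixed_points_increase n : forall I f1 f2 P Q,
  coding I f1 f2 -> I P -> I Q ->
  wcomp f1 f2 (pword n) P = P -> wcomp f1 f2 (pword (S n)) Q = Q -> P < Q.
Proof.
  induction n as [|n IH]; intros I f1 f2 P Q HC HP HQ EP EQ.
  - simpl in *. rewrite <- EP, <- EQ. now apply (coding_sep _ _ _ HC).
  - apply (IH (image f2 I) f2 (block211 f1 f2)).
    + now apply renorm_coding.
    + eapply fixed_point_image; eauto.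
    + eapply fixed_point_image; eauto.
    + rewrite <- wcomp_phi. exact EP.
    + rewrite <- wcomp_phi. exact EQ.
Qed.

Lemma eq_of_geometric_bound (x y C : R) :
  (forall k : nat, Rabs (x - y) <= C * (9 / 16) ^ k) -> x = y.
Proof.
  intros H. assert (Hl : is_lim_seq (fun k => C * (9 / 16) ^ k) 0).
  { replace (Finite 0) with (Rbar_mult (Finite C) (Finite 0))
      by (simpl; now rewrite Rmult_0_r).
    apply is_lim_seq_scal_l, is_lim_seq_geom. rewrite Rabs_pos_eq; lra. }
  assert (Hle : Rbar_le (Rabs (x - y)) 0).
  { eapply is_lim_seq_le; [exact H|apply is_lim_seq_const|exact Hl]. }
  simpl in Hle. pose proof (Rabs_pos (x - y)).
  assert (x - y = 0) by (apply Rabs_eq_0; lra). lra.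
Qed.

Lemma wcomp_contr I f1 f2 U x y :
  coding I f1 f2 -> I x -> I y ->
  Rabs (wcomp f1 f2 U x - wcomp f1 f2 U y) <= Rabs (x - y) /\
  (U <> [] ->
   Rabs (wcomp f1 f2 U x - wcomp f1 f2 U y) <= 9 / 16 * Rabs (x - y)).
Proof.
  intros HC Hx Hy. pose proof (Rabs_pos (x - y)).
  assert (Hs : forall U z, I z -> I (wcomp f1 f2 U z)).
  { intros; apply wcomp_stab; [apply (coding_stab1 _ _ _ HC)
      |apply (coding_stab2 _ _ _ HC)|trivial]. }
  induction U as [|[] U [IH _]]; simpl.
  - split; [lra|congruence].
  - pose proof (coding_contr2 _ _ _ HC _ _ (Hs U x Hx) (Hs U y Hy)).
    split; [|intros _]; lra.
  - pose proof (coding_contr1 _ _ _ HC _ _ (Hs U x Hx) (Hs U y Hy)).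
    split; [|intros _]; lra.
Qed.

Lemma fixed_point_unique I f1 f2 n x y :
  coding I f1 f2 -> I x -> I y ->
  wcomp f1 f2 (pword n) x = x -> wcomp f1 f2 (pword n) y = y -> x = y.
Proof.
  intros HC Hx Hy Ex Ey.
  destruct (wcomp_contr I f1 f2 (pword n) x y HC Hx Hy) as [_ H].
  rewrite Ex, Ey in H. pose proof (Rabs_pos (x - y)).
  assert (Rabs (x - y) <= 9 / 16 * Rabs (x - y)).
  { apply H. destruct (pword_cons n) as (b & W & ->). discriminate. }
  assert (x - y = 0) by (apply Rabs_eq_0; lra). lra.
Qed.

(** A concatenation of blocks 2 and 211 starts with 22 or with 2112, according to its first block,
    as the next block starts with 2. *)
Lemma fixed_point_form I f1 f2 n P :
  coding I f1 f2 -> I P -> wcomp f1 f2 (pword (S n)) P = P ->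
  exists z, I z /\ (P = f2 (f2 z) \/ P = f2 (f1 (f1 (f2 z)))).
Proof.
  intros HC HP EP. assert (HC' := renorm_coding HC).
  assert (HP' := fixed_point_image _ _ _ _ _ HC HP EP).
  simpl in EP. rewrite wcomp_phi in EP. rewrite <- EP.
  destruct (wcomp_pword_image _ _ _ n P (coding_stab1 _ _ _ HC')
              (coding_stab2 _ _ _ HC') HP')
    as [(z & (t & Ht & ->) & ->)|(z & (t & Ht & ->) & ->)]; exists t; auto.
Qed.

(** Each point has an infinite backward [f1]-orbit inside [X]; going back [k] steps bounds the
    distance from [x] to [f1 x] by [3 * (9/16)^k]. *)
Lemma contraction_orbit_fixed I f1 f2 (X : R -> Prop) x :
  coding I f1 f2 -> (forall x, X x -> I x) ->
  (forall x, X x -> exists y, X y /\ x = f1 y) -> X x -> f1 x = x.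
Proof.
  intros HC HI HX Hx. apply eq_of_geometric_bound with (C := 3). intros k.
  revert x Hx. induction k as [|k IHk]; intros x Hx.
  - assert (Hb := coding_bound _ _ _ HC _ (HI x Hx)).
    assert (Hb' := coding_bound _ _ _ HC _
                     (coding_stab1 _ _ _ HC _ (HI x Hx))).
    simpl. apply Rabs_le. lra.
  - destruct (HX x Hx) as (z & Hz & ->). specialize (IHk z Hz).
    pose proof (coding_contr1 _ _ _ HC _ _
                  (coding_stab1 _ _ _ HC _ (HI z Hz)) (HI z Hz)).
    simpl. lra.
Qed.

(* If [L] is coded by the first letter [1], maximality forces every point of
   [X] to be coded by [1] forever.  Otherwise maximality and [L < P] forbid
   the factors [212] and [2111], so the points coded by [2] are
   coded by the blocks [2] and [211]. *)
Lemma max_is_fixed_point n : forall I f1 f2 (X : R -> Prop) L P,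
  coding I f1 f2 -> (forall x, X x -> I x) ->
  (forall x, X x -> exists y, X y /\ (x = f1 y \/ x = f2 y)) ->
  X L -> (forall x, X x -> x <= L) ->
  I P -> wcomp f1 f2 (pword n) P = P -> L < P ->
  exists j, wcomp f1 f2 (pword j) L = L.
Proof.
  induction n as [|n IH]; intros I f1 f2 X L P HC HI HX HL Hmax HP EP HLP.
  all: destruct (classic (exists y, X y /\ L = f2 y)) as [(y & Hy & EL)|HN].
  2, 4: exists 0%nat; simpl; destruct (HX L HL) as (y & Hy & [Ey|Ey]);
    [|exfalso; apply HN; now exists y];
    apply (contraction_orbit_fixed I f1 f2 X L HC HI); [|exact HL];
    intros x Hx; destruct (HX x Hx) as (z & Hz & [Ez|Ez]); [now exists z|];
    specialize (Hmax x Hx); rewrite Ez, Ey in Hmax;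
    pose proof (coding_sep _ _ _ HC y z (HI y Hy) (HI z Hz)); lra.
  (* At level 0 the point [P = f1 P] lies below every image of [f2], hence below [L]. *)
  { exfalso. simpl in EP. rewrite <- EP, EL in HLP.
    pose proof (coding_sep _ _ _ HC P y HP (HI y Hy)). lra. }
  assert (HC' := renorm_coding HC).
  assert (HP' := fixed_point_image _ _ _ _ _ HC HP EP).
  assert (HPform := fixed_point_form _ _ _ _ _ HC HP EP).
  simpl in EP. rewrite wcomp_phi in EP.
  assert (S1 := coding_stab1 _ _ _ HC). assert (S2 := coding_stab2 _ _ _ HC).
  assert (sep := coding_sep _ _ _ HC).
  assert (D1 := coding_decr1 _ _ _ HC). assert (D2 := coding_decr2 _ _ _ HC).
  (* In the alternating order, anything starting with 212 or 2111 lies above anything starting with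
     22 or 2112, so these factors would exceed [P > L]. *)
  assert (Hlt : forall x, I x -> P < f2 (f1 (f2 x)) /\
                  P < f2 (f1 (f1 (f1 x)))).
  { intros x Hx. destruct HPform as (z & Hz & [->| ->]); split;
    repeat first [apply sep | apply D2 | apply D1 | apply S1 | apply S2
                 | assumption]. }
  destruct (IH (image f2 I) f2 (block211 f1 f2)
              (fun x => X x /\ exists y, X y /\ x = f2 y) L P) as (j & Ej);
    auto.
  - intros x (_ & z & Hz & ->). exists z. auto.
  - intros x (Hx & z & Hz & ->). specialize (Hmax _ Hx).
    destruct (HX z Hz) as (t & Ht & [->| ->]);
      [|exists (f2 t); split; [split|left]; eauto].
    destruct (HX t Ht) as (u & Hu & [->| ->]);
      [|destruct (Hlt u (HI u Hu)); lra].
    destruct (HX u Hu) as (v & Hv & [->| ->]);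
      [destruct (Hlt v (HI v Hv)); lra|].
    exists (f2 v). split; [split|right]; eauto.
  - eauto.
  - intros x (Hx & _). auto.
  - exists (S j). simpl. now rewrite wcomp_phi.
Qed.

(** * Continued fractions with digits 1 and 2 *)

(** An interval that both maps send into itself; its left end 4/3 makes the derivative [1/x^2] at
    most 9/16. *)
Definition base_dom (x : R) : Prop := 4 / 3 <= x <= 3.
Definition quot1 (x : R) : R := 1 + / x.
Definition quot2 (x : R) : R := 2 + / x.

Lemma Rinv_bounds a b x : 0 < a -> a <= x <= b -> / b <= / x <= / a.
Proof. intros Ha Hx. split; apply Rinv_le_contravar; lra. Qed.

Lemma Rinv_dist x y : 0 < x -> 0 < y ->
  Rabs (/ x - / y) = / (x * y) * Rabs (x - y).
Proof.
  intros Hx Hy. replace (/ x - / y) with (/ (x * y) * (y - x)) by (field; lra).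
  rewrite Rabs_mult, (Rabs_minus_sym y x), Rabs_pos_eq; [reflexivity|].
  apply Rlt_le, Rinv_0_lt_compat. nra.
Qed.

Lemma base_coding : coding base_dom quot1 quot2.
Proof.
  assert (HI : forall x, base_dom x -> 1 / 3 <= / x <= 3 / 4).
  { intros x Hx. pose proof (Rinv_bounds (4 / 3) 3 x ltac:(lra) Hx). lra. }
  assert (Hd : forall x y, base_dom x -> base_dom y -> x < y -> / y < / x).
  { intros x y Hx Hy Hxy. unfold base_dom in *.
    apply Rinv_lt_contravar; nra. }
  assert (Hc : forall x y, base_dom x -> base_dom y ->
    Rabs (/ x - / y) <= 9 / 16 * Rabs (x - y)).
  { intros x y Hx Hy. unfold base_dom in *. rewrite Rinv_dist by lra.
    apply Rmult_le_compat_r; [apply Rabs_pos|].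
    replace (9 / 16) with (/ (4 / 3 * (4 / 3))) by field.
    apply Rinv_le_contravar; nra. }
  unfold quot1, quot2.
  split.
  - intros x Hx. specialize (HI x Hx). unfold base_dom. lra.
  - intros x Hx. specialize (HI x Hx). unfold base_dom. lra.
  - intros x y Hx Hy Hxy. specialize (Hd x y Hx Hy Hxy). lra.
  - intros x y Hx Hy Hxy. specialize (Hd x y Hx Hy Hxy). lra.
  - intros x y Hx Hy. pose proof (HI x Hx). pose proof (HI y Hy). lra.
  - intros x y Hx Hy. replace (1 + / x - (1 + / y)) with (/ x - / y) by ring.
    auto.
  - intros x y Hx Hy. replace (2 + / x - (2 + / y)) with (/ x - / y) by ring.
    auto.
  - unfold base_dom. intros x Hx. lra.
Qed.

(** Extends the composed maps continuously to the whole line, where the intermediate value theorem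
    is applied. *)
Definition clamp (x : R) : R := Rmax (4 / 3) (Rmin x 3).

Lemma clamp_dom x : base_dom (clamp x).
Proof.
  unfold clamp, base_dom. split; [apply Rmax_l|].
  apply Rmax_lub; [lra|apply Rmin_r].
Qed.

Lemma clamp_id x : base_dom x -> clamp x = x.
Proof.
  intros Hx. unfold clamp, base_dom in *.
  rewrite Rmin_left, Rmax_right; lra.
Qed.

Lemma clamp_lipschitz x y : Rabs (clamp x - clamp y) <= Rabs (x - y).
Proof.
  unfold clamp, Rmax, Rmin. repeat destruct Rle_dec; split_Rabs; lra.
Qed.

Lemma base_fixed_point n :
  {P : R | base_dom P /\ wcomp quot1 quot2 (pword n) P = P}.
Proof.
  set (h := fun x => wcomp quot1 quot2 (pword n) (clamp x) - x).
  assert (Hdom : forall x, base_dom (wcomp quot1 quot2 (pword n) (clamp x))).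
  { intros x. apply wcomp_stab; [apply base_coding|apply base_coding|].
    apply clamp_dom. }
  destruct (IVT_cor h (4 / 3) 3) as (P & HP & E).
  (* [h] is the difference of two 1-Lipschitz functions, so [eps / 2] suffices. *)
  - intros x eps Heps. exists (eps / 2). split; [lra|].
    intros y [_ Hy]. simpl in *. unfold Rdist in *. unfold h.
    destruct (wcomp_contr _ _ _ (pword n) _ _ base_coding (clamp_dom y)
                (clamp_dom x)) as [H _].
    pose proof (clamp_lipschitz y x). split_Rabs; lra.
  - lra.
  - unfold h. pose proof (Hdom (4 / 3)) as [H1 _].
    pose proof (Hdom 3) as [_ H2].
    nra.
  - exists P. split; [exact HP|]. unfold h in E.
    rewrite clamp_id in E by exact HP. lra.
Qed.

Definition lambda (n : nat) : R := proj1_sig (base_fixed_point n).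

Lemma lambda_dom n : base_dom (lambda n).
Proof. exact (proj1 (proj2_sig (base_fixed_point n))). Qed.

Lemma lambda_fixed n : wcomp quot1 quot2 (pword n) (lambda n) = lambda n.
Proof. exact (proj2 (proj2_sig (base_fixed_point n))). Qed.

Lemma lambda_unique n x :
  base_dom x -> wcomp quot1 quot2 (pword n) x = x -> x = lambda n.
Proof.
  intros Hx E. apply (fixed_point_unique _ _ _ n _ _ base_coding); auto.
  - apply lambda_dom.
  - apply lambda_fixed.
Qed.

Lemma lambda_increasing n : lambda n < lambda (S n).
Proof.
  apply (fixed_points_increase n _ _ _ _ _ base_coding);
  auto using lambda_dom, lambda_fixed.
Qed.

(** By monotonicity it suffices to treat expansions starting with 22 or 2112; the latter give the
    larger bound [[2; 1, 1, 2, 3] = 44/17]. It becomes [2 - 17/61 = 105/61] for the [sigma_val], the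
    threshold on ratios used later. *)
Lemma lambda_bound n : lambda n <= 44 / 17.
Proof.
  apply Rle_trans with (lambda (S n)); [apply Rlt_le, lambda_increasing|].
  destruct (fixed_point_form _ _ _ n _ base_coding (lambda_dom _)
              (lambda_fixed _)) as (z & Hz & [-> | ->]);
  unfold quot1, quot2;
  pose proof (Rinv_bounds (4 / 3) 3 z ltac:(lra) Hz) as H1;
  pose proof (Rinv_bounds (7 / 3) 3 (2 + / z) ltac:(lra) ltac:(lra)) as H2.
  - lra.
  - pose proof (Rinv_bounds (4 / 3) (10 / 7) (1 + / (2 + / z)) ltac:(lra)
                  ltac:(lra)) as H3.
    pose proof (Rinv_bounds (17 / 10) 2 (1 + / (1 + / (2 + / z))) ltac:(lra)
                  ltac:(lra)) as H4.
    lra.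
Qed.

Lemma sqrt_bounds a b x : 0 <= a -> 0 <= b -> a * a <= x <= b * b ->
  a <= sqrt x <= b.
Proof.
  intros Ha Hb Hx. split.
  - rewrite <- (sqrt_square a Ha). apply sqrt_le_1_alt; lra.
  - rewrite <- (sqrt_square b Hb). apply sqrt_le_1_alt; lra.
Qed.

Lemma lambda_0 : lambda 0 = (1 + sqrt 5) / 2.
Proof.
  symmetry. apply lambda_unique.
  - pose proof (sqrt_bounds 2 3 5 ltac:(lra) ltac:(lra) ltac:(lra)).
    unfold base_dom. lra.
  - simpl. unfold quot1.
    pose proof (sqrt_sqrt 5 ltac:(lra)). pose proof (sqrt_pos 5).
    apply Rmult_eq_reg_r with ((1 + sqrt 5) / 2); [|lra].
    field_simplify; [|lra..]. nra.
Qed.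

Lemma lambda_1 : lambda 1 = 1 + sqrt 2.
Proof.
  symmetry. apply lambda_unique.
  - pose proof (sqrt_bounds 1 2 2 ltac:(lra) ltac:(lra) ltac:(lra)).
    unfold base_dom. lra.
  - simpl. unfold quot2.
    pose proof (sqrt_sqrt 2 ltac:(lra)). pose proof (sqrt_pos 2).
    apply Rmult_eq_reg_r with (1 + sqrt 2); [|lra].
    field_simplify; [|lra..]. nra.
Qed.

Lemma lambda_2 : lambda 2 = 1 + sqrt 10 / 2.
Proof.
  symmetry. apply lambda_unique.
  - pose proof (sqrt_bounds 3 4 10 ltac:(lra) ltac:(lra) ltac:(lra)).
    unfold base_dom. lra.
  - simpl. unfold quot1, quot2.
    pose proof (sqrt_sqrt 10 ltac:(lra)). pose proof (sqrt_pos 10).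
    set (y := 1 + sqrt 10 / 2). assert (Hy : 1 <= y) by (unfold y; lra).
    assert (Eq : 2 * (y * y) = 4 * y + 3) by (unfold y; nra).
    replace (2 + / (1 + / (1 + / y))) with ((5 * y + 3) / (2 * y + 1))
      by (field; lra).
    apply Rmult_eq_reg_r with (2 * y + 1); [|lra].
    field_simplify; [|lra..]. nra.
Qed.

(** * Words realising the periodic continued fractions *)

(** When [x] is the fixed point of [W], the suffix values are the points of its periodic orbit. *)
Fixpoint all_suffixes (Q : R -> Prop) f1 f2 (W : list bool) (x : R) : Prop :=
  Q (wcomp f1 f2 W x) /\
  match W with [] => True | _ :: W' => all_suffixes Q f1 f2 W' x end.

Lemma all_suffixes_skipn Q f1 f2 W x k :
  all_suffixes Q f1 f2 W x -> Q (wcomp f1 f2 (skipn k W) x).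
Proof.
  revert k. induction W as [|b W IH]; intros k [H H'].
  - now destruct k.
  - destruct k as [|k]; [exact H|]. now apply IH.
Qed.

(** A suffix starting inside a block 211 begins with the digit 1 and so lies below [B], an image of
    [f2]; the other suffixes are those of [W] one level up. *)
Lemma all_suffixes_phi I f1 f2 W x B :
  coding I f1 f2 -> image f2 I x -> image f2 I B ->
  all_suffixes (fun y => y <= B) f2 (block211 f1 f2) W x ->
  all_suffixes (fun y => y <= B) f1 f2 (phi W) x.
Proof.
  intros HC Hx (t & Ht & HB).
  induction W as [|b W IH]; [trivial|]. intros [H H']. specialize (IH H').
  assert (Hy : I (wcomp f1 f2 (phi W) x)).
  { apply wcomp_stab; [apply HC|apply HC|now apply (image_sub HC)]. }
  rewrite <- wcomp_phi in H.
  destruct b; simpl in *; repeat split; try exact H; try exact IH.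
  - apply Rlt_le. rewrite HB. apply (coding_sep _ _ _ HC); [|exact Ht].
    now apply (coding_stab1 _ _ _ HC).
  - apply Rlt_le. rewrite HB. now apply (coding_sep _ _ _ HC).
Qed.

Lemma fixed_point_dominates n : forall I f1 f2 P,
  coding I f1 f2 -> I P -> wcomp f1 f2 (pword n) P = P ->
  all_suffixes (fun y => y <= P) f1 f2 (pword n) P.
Proof.
  induction n as [|n IH]; intros I f1 f2 P HC HP EP.
  - simpl in *. repeat split; lra.
  - assert (HP' := fixed_point_image _ _ _ _ _ HC HP EP).
    apply (all_suffixes_phi I); auto.
    apply (IH (image f2 I)); [now apply renorm_coding|exact HP'|].
    rewrite <- wcomp_phi. exact EP.
Qed.

(* The additive steps of the continued fraction algorithm: the letter [true]
   continues the current run of the directive word, [false] starts a new run. *)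
Definition incr (x : R) : R := x + 1.

Definition slow (W : list bool) : list bool :=
  flat_map (fun b : bool => if b then [true; false] else [false]) W.

Lemma wcomp_slow W x : wcomp quot1 incr (slow W) x = wcomp quot1 quot2 W x.
Proof.
  induction W as [|[] W IH]; [reflexivity| |]; simpl; rewrite <- IH.
  - unfold incr, quot1, quot2, slow. ring.
  - reflexivity.
Qed.

(** The only new suffixes start in the middle of a digit 2; their value [1 + 1/y] is one less than
    that of the full digit and still at least 4/3. *)
Lemma all_suffixes_slow W x B :
  base_dom x -> all_suffixes (fun y => y <= B) quot1 quot2 W x ->
  all_suffixes (fun y => 4 / 3 <= y <= B) quot1 incr (slow W) x.
Proof.
  intros Hx. induction W as [|b W IH]; intros [H H'].
  - simpl in *. unfold base_dom in Hx. repeat split; lra.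
  - specialize (IH H').
    assert (Hy : base_dom (wcomp quot1 incr (slow W) x)).
    { rewrite wcomp_slow. apply wcomp_stab; [apply base_coding..|exact Hx]. }
    pose proof (Rinv_bounds (4 / 3) 3 _ ltac:(lra) Hy) as Hi.
    rewrite <- (wcomp_slow (b :: W)) in H.
    destruct b; simpl in *; change (flat_map _ W) with (slow W) in *;
    unfold incr, quot1 in *; repeat split; try exact IH; lra.
Qed.

Lemma slow_last W : W <> [] -> exists U, slow W = U ++ [false].
Proof.
  intros HW. destruct (exists_last HW) as (V & b & ->). unfold slow.
  rewrite flat_map_app. destruct b; simpl.
  - exists (flat_map (fun b : bool => if b then [true; false] else [false]) V
              ++ [true]). now rewrite <- app_assoc.
  - eexists. reflexivity.
Qed.

Lemma skipn_nth {T : Type} (l : list T) a k : (k < length l)%nat ->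
  skipn k l = nth k l a :: skipn (S k) l.
Proof.
  revert k; induction l as [|b l IH]; intros [|k] Hk; simpl in *; try lia.
  - reflexivity.
  - apply IH. lia.
Qed.

Section PeriodicOrbit.
Variables (U : list bool) (P : R).
Let l := length (U ++ [false]).

(** The word is read backwards, because the newest digit of the ratio is its outermost one. The
    final [false] makes each period begin with a [quot1] step applied to [P]. *)
Definition periodic_flag (i : nat) : bool :=
  nth (l - 1 - i mod l) (U ++ [false]) false.

Definition orbit (i : nat) : R :=
  wcomp quot1 incr (skipn (l - i mod l) (U ++ [false])) P.

Lemma periodic_flag_start k : periodic_flag (k * l) = false.
Proof.
  unfold periodic_flag. rewrite Nat.Div0.mod_mul.
  unfold l. rewrite length_app. simpl.
  rewrite app_nth2 by lia. now replace (_ - _)%nat with 0%nat by lia.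
Qed.

Lemma orbit_start k : orbit (k * l) = P.
Proof.
  unfold orbit. rewrite Nat.Div0.mod_mul, Nat.sub_0_r. unfold l.
  now rewrite skipn_all.
Qed.

Lemma orbit_S i :
  wcomp quot1 incr (U ++ [false]) P = P ->
  orbit (S i) = if periodic_flag i then incr (orbit i) else quot1 (orbit i).
Proof.
  intros EP. assert (Hl : (0 < l)%nat)
    by (unfold l; rewrite length_app; simpl; lia).
  assert (Hj := Nat.mod_upper_bound i l ltac:(lia)).
  assert (HS : orbit (S i) =
    wcomp quot1 incr (skipn (l - 1 - i mod l) (U ++ [false])) P).
  (* At the end of a period the whole word has been applied, and [EP] closes the orbit. *)
  { destruct (Nat.eq_dec (S (i mod l)) l) as [He|He].
    - replace (l - 1 - i mod l)%nat with 0%nat by lia.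
      simpl skipn. rewrite EP.
      replace (S i) with ((i / l + 1) * l)%nat; [apply orbit_start|].
      pose proof (Nat.div_mod_eq i l). nia.
    - unfold orbit. f_equal. f_equal.
      assert (E : (S i mod l = S (i mod l))%nat).
      { symmetry. apply (Nat.mod_unique _ _ (i / l)); [lia|].
        pose proof (Nat.div_mod_eq i l). lia. }
      rewrite E. lia. }
  rewrite HS, (skipn_nth _ false) by (fold l; lia).
  unfold periodic_flag, orbit.
  replace (S (l - 1 - i mod l)) with (l - i mod l)%nat by lia.
  reflexivity.
Qed.

End PeriodicOrbit.

(** * Ratios of the two periods along a directive word *)

Fixpoint directive (flag : nat -> bool) (i : nat) : bool :=
  match i with
  | O => true
  | S i => if flag i then directive flag i else negb (directive flag i)
  end.

Section RatioOrbit.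
Variable flag : nat -> bool.
Let d := directive flag.

Definition cur_per (i : nat) : R := INR (per d (S i) (d i)).
Definition other_per (i : nat) : R := INR (per d (S i) (negb (d i))).
Definition per_ratio (i : nat) : R := other_per i / cur_per i.

Lemma cur_per_ge1 i : 1 <= cur_per i.
Proof. apply (le_INR 1). apply per_pos. Qed.

Lemma periods_S i :
  (cur_per (S i), other_per (S i)) =
  if flag i then (cur_per i, other_per i + cur_per i)
  else (other_per i, cur_per i + other_per i).
Proof.
  unfold cur_per, other_per. rewrite per_same, per_other, plus_INR.
  change (d (S i)) with (if flag i then d i else negb (d i)).
  destruct (flag i); [reflexivity|]. now rewrite negb_involutive.
Qed.

Lemma other_ge_cur i : cur_per i <= other_per i.
Proof.
  destruct i as [|i].
  - unfold cur_per, other_per. simpl. lra.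
  - pose proof (periods_S i) as H. pose proof (cur_per_ge1 i).
    assert (0 <= other_per i) by apply pos_INR.
    destruct (flag i); injection H as -> ->; lra.
Qed.

Lemma per_ratio_ge1 i : 1 <= per_ratio i.
Proof.
  pose proof (cur_per_ge1 i). pose proof (other_ge_cur i). unfold per_ratio.
  apply Rmult_le_reg_r with (cur_per i); [lra|]. field_simplify; lra.
Qed.

Lemma per_ratio_S i :
  per_ratio (S i) = if flag i then incr (per_ratio i) else quot1 (per_ratio i).
Proof.
  pose proof (periods_S i) as H. pose proof (cur_per_ge1 i).
  pose proof (other_ge_cur i). unfold per_ratio, incr, quot1.
  destruct (flag i); injection H as -> ->; field; lra.
Qed.

Lemma per_ratio_0 : per_ratio 0 = 2.
Proof. unfold per_ratio, other_per, cur_per. simpl. lra. Qed.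

Lemma len_S_per_ratio i :
  INR (len d (S i)) + 2 = cur_per i * (1 + per_ratio i).
Proof.
  pose proof (cur_per_ge1 i). unfold per_ratio.
  replace (cur_per i * (1 + other_per i / cur_per i))
    with (cur_per i + other_per i) by (field; lra).
  unfold cur_per, other_per. rewrite <- plus_INR, <- (len_per d (S i) (d i)).
  now rewrite plus_INR.
Qed.

Lemma len_SS i :
  INR (len d (S (S i))) =
  INR (len d (S i)) + cur_per i * (if flag i then 1 else per_ratio i).
Proof.
  rewrite len_S, plus_INR. f_equal.
  change (d (S i)) with (if flag i then d i else negb (d i)).
  pose proof (cur_per_ge1 i). unfold per_ratio.
  destruct (flag i).
  - rewrite Rmult_1_r. reflexivity.
  - transitivity (other_per i); [reflexivity|]. field. lra.
Qed.

Lemma len_S_pos i : 1 <= INR (len d (S i)).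
Proof. apply (le_INR 1). pose proof (len_ge d (S i)). lia. Qed.

(** The length grows by at most the larger period, which is the fraction [x / (1 + x)] of the length
    plus 2; that 2 causes the error term. *)
Lemma len_ratio_upper i :
  INR (len d (S (S i))) / INR (len d (S i)) <=
  1 + per_ratio i / (1 + per_ratio i) + 2 / INR (len d (S i)).
Proof.
  rewrite len_SS. pose proof (len_S_per_ratio i) as E.
  pose proof (per_ratio_ge1 i) as Hx. pose proof (len_S_pos i) as Hn.
  pose proof (cur_per_ge1 i).
  set (x := per_ratio i) in *. set (n := INR (len d (S i))) in *.
  set (p := cur_per i) in *.
  apply Rmult_le_reg_r with n; [lra|].
  replace ((n + p * (if flag i then 1 else x)) / n * n)
    with (n + p * (if flag i then 1 else x)) by (field; lra).
  replace ((1 + x / (1 + x) + 2 / n) * n)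
    with (n + (n + 2) * (x / (1 + x)) + 2 / (1 + x)) by (field; lra).
  rewrite E. replace (p * (1 + x) * (x / (1 + x))) with (p * x) by (field; lra).
  assert (0 < 2 / (1 + x)) by (apply Rdiv_lt_0_compat; lra).
  destruct (flag i); nra.
Qed.

Lemma len_ratio_lower i : flag i = false ->
  1 + per_ratio i / (1 + per_ratio i) <=
  INR (len d (S (S i))) / INR (len d (S i)).
Proof.
  intros Hf. rewrite len_SS, Hf. pose proof (len_S_per_ratio i) as E.
  pose proof (per_ratio_ge1 i) as Hx. pose proof (len_S_pos i) as Hn.
  set (x := per_ratio i) in *. set (n := INR (len d (S i))) in *.
  set (p := cur_per i) in *.
  assert (Ep : p = (n + 2) / (1 + x)) by (rewrite E; field; lra).
  apply Rmult_le_reg_r with n; [lra|]. rewrite Ep.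
  replace ((n + (n + 2) / (1 + x) * x) / n * n)
    with (n + x / (1 + x) * n + 2 * (x / (1 + x))) by (field; lra).
  assert (0 < x / (1 + x)) by (apply Rdiv_lt_0_compat; lra). lra.
Qed.

End RatioOrbit.

Lemma ratio_lipschitz x y : 0 <= x -> 0 <= y ->
  Rabs (x / (1 + x) - y / (1 + y)) <= Rabs (x - y).
Proof.
  intros Hx Hy.
  replace (x / (1 + x) - y / (1 + y)) with (/ (1 + y) - / (1 + x))
    by (field; lra).
  rewrite Rinv_dist by lra.
  replace (1 + y - (1 + x)) with (- (x - y)) by ring. rewrite Rabs_Ropp.
  rewrite <- (Rmult_1_l (Rabs (x - y))) at 2.
  apply Rmult_le_compat_r; [apply Rabs_pos|].
  rewrite <- Rinv_1. apply Rinv_le_contravar; nra.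
Qed.

Lemma ratio_monotone x y : 0 <= x -> x <= y -> x / (1 + x) <= y / (1 + y).
Proof.
  intros Hx Hxy.
  replace (x / (1 + x)) with (1 - / (1 + x)) by (field; lra).
  replace (y / (1 + y)) with (1 - / (1 + y)) by (field; lra).
  pose proof (Rinv_le_contravar (1 + x) (1 + y)). lra.
Qed.

(** The ratio starts at 2 rather than at [P], but the same maps act on it and on the periodic orbit:
    [incr] keeps their distance and each [quot1] shrinks it. So the ratio follows the orbit, whose
    maximum is [P]. *)
Lemma LimSup_periodic_word U P :
  wcomp quot1 incr (U ++ [false]) P = P -> base_dom P ->
  all_suffixes (fun y => 4 / 3 <= y <= P) quot1 incr (U ++ [false]) P ->
  let d := directive (periodic_flag U) in
  is_LimSup_seq (fun i => INR (len d (S (S i))) / INR (len d (S i)))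
    (1 + P / (1 + P)).
Proof.
  intros EP HP Hsuf d. set (l := length (U ++ [false])).
  assert (Hl : (0 < l)%nat) by (unfold l; rewrite length_app; simpl; lia).
  set (x := per_ratio (periodic_flag U)). set (v := orbit U P).
  assert (Hv : forall i, 4 / 3 <= v i <= P).
  { intros i. exact (all_suffixes_skipn _ _ _ _ _ _ Hsuf). }
  assert (Hx : forall i, 1 <= x i) by apply per_ratio_ge1.
  set (e := fun i => Rabs (x i - v i)).
  assert (He0 : forall i, 0 <= e i) by (intros; apply Rabs_pos).
  assert (Hquot : forall i, Rabs (quot1 (x i) - quot1 (v i)) <= 3 / 4 * e i).
  { intros i. unfold quot1.
    replace (1 + / x i - (1 + / v i)) with (/ x i - / v i) by ring.
    specialize (Hv i). specialize (Hx i). rewrite Rinv_dist by lra.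
    apply Rmult_le_compat_r; [apply He0|].
    replace (3 / 4) with (/ (4 / 3)) by field.
    apply Rinv_le_contravar; nra. }
  assert (Hdec : forall i, e (S i) <= e i).
  { intros i. unfold e at 1, x, v.
    rewrite per_ratio_S, (orbit_S U P i EP). destruct (periodic_flag U i).
    - unfold incr. fold x v. right. unfold e. f_equal. ring.
    - eapply Rle_trans; [apply Hquot|]. specialize (He0 i). lra. }
  assert (Hmono : forall i j, (i <= j)%nat -> e j <= e i).
  { induction 1 as [|j _ IH]; [lra|]. specialize (Hdec j). lra. }
  assert (Hgeom : forall k, e (k * l)%nat <= 2 * (3 / 4) ^ k).
  { induction k as [|k IH].
    - unfold e, x, v. rewrite per_ratio_0, orbit_start. unfold base_dom in HP.
      simpl. apply Rabs_le. lra.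
    - eapply Rle_trans; [apply (Hmono (S (k * l))); simpl; lia|].
      unfold e, x, v. rewrite per_ratio_S, (orbit_S U P _ EP).
      replace (periodic_flag U (k * l)) with false
        by (symmetry; apply periodic_flag_start).
      fold x v.
      eapply Rle_trans; [apply Hquot|]. simpl. lra. }
  assert (Hlim : forall eps : posreal, exists K, forall i, (K <= i)%nat ->
            e i < eps).
  { intros eps.
    destruct (pow_lt_1_zero (3 / 4) ltac:(rewrite Rabs_pos_eq; lra) (eps / 2))
      as (K & HK); [destruct eps; simpl; lra|].
    exists (K * l)%nat. intros i Hi. apply Hmono in Hi.
    specialize (Hgeom K). specialize (HK K (le_n K)).
    rewrite Rabs_pos_eq in HK by (apply pow_le; lra). lra. }
  assert (HPv : 4 / 3 <= P <= 3) by exact HP.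
  intros eps. split.
  - intros N. destruct (Hlim eps) as (K & HK).
    (* At multiples of [l] the orbit is at [P] and a new run starts, so the lower bound on the
       length ratio applies. *)
    set (i := ((N + K) * l)%nat). exists i.
    assert (Hi : (N + K <= i)%nat) by (unfold i; nia).
    split; [lia|].
    assert (Hf : periodic_flag U i = false) by apply periodic_flag_start.
    assert (Hvi : v i = P) by apply orbit_start.
    pose proof (len_ratio_lower _ i Hf) as H. fold d x in H.
    specialize (HK i ltac:(lia)). unfold e in HK. rewrite Hvi in HK.
    pose proof (ratio_lipschitz (x i) P ltac:(specialize (Hx i); lra)
                  ltac:(lra)) as HL.
    apply Rabs_le_between in HL. lra.
  - assert (Hpos : 0 < eps / 4) by (destruct eps; simpl; lra).
    destruct (Hlim (mkposreal _ Hpos)) as (K & HK).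
    (* Beyond [M] the length exceeds [4 / eps], which makes the error term at most [eps / 2]. *)
    destruct (nfloor_ex (4 / eps)) as (M & HM).
    { apply Rlt_le, Rdiv_lt_0_compat; [lra|apply cond_pos]. }
    exists (K + M)%nat. intros i Hi.
    pose proof (len_ratio_upper (periodic_flag U) i) as H. fold d x in H.
    specialize (HK i ltac:(lia)). simpl in HK.
    pose proof (ratio_lipschitz (x i) (v i) ltac:(specialize (Hx i); lra)
                  ltac:(specialize (Hv i); lra)) as HL.
    pose proof (ratio_monotone (v i) P ltac:(specialize (Hv i); lra)
                  ltac:(specialize (Hv i); lra)).
    assert (Hn : 4 / eps < INR (len d (S i))).
    { apply Rlt_le_trans with (INR M + 1); [lra|].
      rewrite <- S_INR. apply le_INR. pose proof (len_ge d (S i)). lia. }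
    assert (Hq : 2 / INR (len d (S i)) <= eps / 2).
    { assert (0 < eps) by apply cond_pos.
      assert (0 < 4 / eps) by (apply Rdiv_lt_0_compat; lra).
      apply Rmult_le_reg_r with (INR (len d (S i))); [lra|].
      replace (2 / INR (len d (S i)) * INR (len d (S i))) with 2
        by (field; lra).
      replace 2 with (eps / 2 * (4 / eps)) at 1 by (field; lra).
      apply Rmult_le_compat_l; lra. }
    unfold e in HK. apply Rabs_le_between in HL. lra.
Qed.

Lemma lambda_realised n : in_D0 (1 + lambda n / (1 + lambda n)).
Proof.
  destruct (slow_last (pword n)) as (U & HU).
  { destruct (pword_cons n) as (b & W & ->). discriminate. }
  set (d := directive (periodic_flag U)).
  exists bool, (standard_word d).
  split; [apply standard_word_abundant|].
  exists (len d). split; [apply standard_word_pal_lengths|].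
  apply is_LimSup_seq_unique, LimSup_periodic_word.
  - rewrite <- HU, wcomp_slow. apply lambda_fixed.
  - apply lambda_dom.
  - rewrite <- HU. apply all_suffixes_slow; [apply lambda_dom|].
    apply (fixed_point_dominates n base_dom);
      [apply base_coding|apply lambda_dom|apply lambda_fixed].
Qed.

(** * Words with small ratios of palindromic prefixes *)

Lemma last_before (Q : nat -> Prop) s0 j : Q s0 -> (s0 <= j)%nat ->
  exists s, (s0 <= s <= j)%nat /\ Q s /\ forall t, (s < t <= j)%nat -> ~ Q t.
Proof.
  intros H0. induction 1 as [|j Hj (s & Hs & HQ & Hlast)].
  - exists s0. repeat split; auto; lia.
  - destruct (classic (Q (S j))) as [HS|HS].
    + exists (S j). repeat split; auto; lia.
    + exists s. repeat split; [lia|lia|exact HQ|]. intros t Ht.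
      destruct (Nat.eq_dec t (S j)) as [->|]; [exact HS|]. apply Hlast; lia.
Qed.

Section Gaps.
Local Open Scope nat_scope.
Context {A : Type} {w : nat -> A} {n : nat -> nat} (Hn : pal_lengths w n).

Definition gap (i : nat) : nat := n (S i) - n i.
Definition switch (i : nat) : Prop := gap i < gap (S i).

Lemma n_S i : n (S i) = n i + gap i.
Proof. unfold gap. destruct Hn as [H _]. specialize (H i). lia. Qed.

Lemma gap_pos i : 1 <= gap i.
Proof. unfold gap. destruct Hn as [H _]. specialize (H i). lia. Qed.

Lemma n_le i j : i <= j -> n i <= n j.
Proof. induction 1 as [|j _ IH]; [lia|]. rewrite n_S. lia. Qed.

Lemma n_ge i : i <= n i.
Proof.
  induction i as [|i IH]; [lia|]. rewrite n_S. pose proof (gap_pos i). lia.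
Qed.

Lemma n_pal i : pal_prefix w (n i).
Proof. apply Hn. now exists i. Qed.

Lemma pal_prefix_below k i : pal_prefix w k -> k < n (S i) -> k <= n i.
Proof.
  intros Hk Hlt. apply Hn in Hk as (j & <-).
  destruct (Nat.le_gt_cases j i) as [Hj|Hj]; [now apply n_le|].
  apply (n_le (S i) j) in Hj. lia.
Qed.

Lemma n_period i : prefix_period w (n (S i)) (gap i).
Proof.
  apply pal_prefix_period; [apply n_pal..|]. rewrite n_S. lia.
Qed.

Lemma n_sub_gap_pal i : pal_prefix w (n i - gap i).
Proof.
  apply pal_prefix_sub_period; [apply n_pal|].
  apply (prefix_period_le _ _ (n (S i))); [rewrite n_S; lia|apply n_period].
Qed.

(** Going back by [gap (S i)] from [n (S i)] reaches a shorter palindromic prefix, hence at most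
    [n i], unless the gap already exceeds [n (S i)]. *)
Lemma gap_mono i : gap i <= gap (S i).
Proof.
  pose proof (gap_pos (S i)) as Hp. pose proof (n_S i).
  destruct (Nat.le_gt_cases (gap (S i)) (n (S i))) as [Hle|Hgt]; [|lia].
  pose proof (pal_prefix_below _ i (n_sub_gap_pal (S i))). lia.
Qed.

(* If both periods fitted into the prefix of length [n (S i)], the shorter one
   would propagate to the prefix of length [n (S (S i))]. *)
Lemma switch_overlap i : switch i -> n (S i) < gap (S i) + gap i.
Proof.
  intros Hsw. unfold switch in Hsw.
  apply Nat.nle_gt. intros Hle.
  pose proof (gap_pos i). pose proof (n_S (S i)).
  assert (Hp : prefix_period w (n (S (S i))) (gap i)).
  { intros j Hj. destruct (Nat.lt_ge_cases (j + gap i) (n (S i))) as [Hlt|Hge].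
    - now apply n_period.
    - assert (HP := n_period (S i)).
      replace j with (j - gap (S i) + gap (S i)) at 1 by lia.
      replace (j + gap i) with (j - gap (S i) + gap i + gap (S i)) by lia.
      rewrite <- !HP by lia. apply n_period. lia. }
  assert (Hpal := pal_prefix_sub_period _ _ _ (n_pal _) Hp).
  apply (pal_prefix_below _ (S i)) in Hpal; lia.
Qed.

Lemma not_switch i : ~ switch i -> gap (S i) = gap i.
Proof. unfold switch. pose proof (gap_mono i). lia. Qed.

Lemma gap_run s t : (forall j, s < j < s + S t -> ~ switch j) ->
  gap (s + S t) = gap (S s) /\
  n (S (s + S t)) = n (S s) + S t * gap (S s).
Proof.
  induction t as [|t IH]; intros Hns.
  - replace (s + 1) with (S s) by lia. rewrite (n_S (S s)). lia.
  - destruct IH as [E1 E2]; [intros; apply Hns; lia|].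
    assert (E : gap (s + S (S t)) = gap (S s)).
    { rewrite <- E1. replace (s + S (S t)) with (S (s + S t)) by lia.
      apply not_switch, Hns. lia. }
    split; [exact E|]. rewrite n_S, E.
    replace (s + S (S t)) with (S (s + S t)) by lia. rewrite E2. lia.
Qed.

(* The palindromic prefix [n (S i) - gap (S i)] is shorter than [gap i], so it
   is at most [n s].  If it were smaller still, [gap (S i)] would exceed
   44/61 of [n (S i)]; so would it if the run were longer than 2. *)
Lemma switch_step I0 s i :
  (forall j, I0 <= j -> 61 * gap j < 44 * n j) ->
  S I0 <= s -> s < i -> switch s -> switch i ->
  (forall j, s < j < i -> ~ switch j) ->
  exists a, i = s + a /\ (a = 1 \/ a = 2) /\ gap i = gap (S s) /\
    gap (S i) = a * gap (S s) + gap s /\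
    n (S i) = n (S s) + a * gap (S s).
Proof.
  intros Hrho Hs Hsi Sws Swi Hns.
  destruct s as [|s']; [lia|]. set (s := S s') in *.
  assert (exists t, i = s + S t) as (t & ->)
    by (exists (i - s - 1); lia).
  destruct (gap_run s t Hns) as [Eg En].
  exists (S t).
  pose proof (switch_overlap _ Sws) as H1.
  pose proof (switch_overlap _ Swi) as H2. rewrite Eg in H2.
  pose proof (Hrho s ltac:(lia)) as H3.
  pose proof (Hrho (S s) ltac:(lia)) as H4.
  pose proof (Hrho (S (s + S t)) ltac:(lia)) as H5.
  pose proof (n_sub_gap_pal (S (s + S t))) as Hq.
  pose proof (n_S s) as H6. pose proof (n_S s') as H7. fold s in H7.
  pose proof (gap_mono s') as H8. fold s in H8.
  rewrite En in *.
  set (V := gap (S s)) in *. set (aV := S t * V) in *.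
  set (g := gap (S (s + S t))) in *.
  assert (HaV : V <= aV) by (unfold aV; nia).
  assert (Hle : n (S s) + aV - g <= n s)
    by (apply pal_prefix_below; [exact Hq|lia]).
  assert (Heq : n (S s) + aV - g = n s).
  { apply Nat.le_antisymm; [exact Hle|]. apply Nat.nlt_ge. intros Hlt.
    pose proof (pal_prefix_below _ s' Hq Hlt) as Hle'.
    (* Whether or not [s'] is a switch, the 44/61 bounds are contradictory; at a switch the overlap
       inequality is needed as well. *)
    destruct (Nat.eq_dec (gap s') (gap s)) as [HA|HB]; [lia|].
    assert (H9 : n (S s') < gap (S s') + gap s')
      by (apply switch_overlap; unfold switch; fold s; lia).
    fold s in H9. lia. }
  repeat split; try lia.
  destruct t as [|[|t]]; [now left|now right|exfalso].
  (* Now [g = aV + gap s] and [n (S s) < V + gap s], so [61 g < 44 (n (S s) + aV)] forces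
     [17 aV < 44 V]. *)
  assert (3 * V <= aV) by (unfold aV; nia). lia.
Qed.

Lemma switch_recurrence I0 s0 :
  (forall j, I0 <= j -> 61 * gap j < 44 * n j) ->
  S I0 <= s0 -> switch s0 ->
  forall i, s0 < i -> switch i ->
  exists s a, s0 <= s /\ i = s + a /\ (a = 1 \/ a = 2) /\ switch s /\
    gap i = gap (S s) /\ gap (S i) = a * gap (S s) + gap s /\
    n (S i) = n (S s) + a * gap (S s).
Proof.
  intros Hrho Hs0 Sw0 i Hi Swi.
  destruct (last_before switch s0 (i - 1) Sw0 ltac:(lia))
    as (s & Hs & Sws & Hlast).
  destruct (switch_step I0 s i Hrho) as (a & ?); auto; try lia.
  { intros j Hj. apply Hlast. lia. }
  exists s, a. intuition lia.
Qed.

(** From one switch to the next, the sum of the two gaps and the prefix length both grow by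
    [a * gap (S s)]. The constant difference plays the part of the 2 in a central word. *)
Lemma switch_defect I0 s0 :
  (forall j, I0 <= j -> 61 * gap j < 44 * n j) ->
  S I0 <= s0 -> switch s0 ->
  forall i, s0 <= i -> switch i ->
  gap (S i) + gap i = n (S i) + (gap (S s0) + gap s0 - n (S s0)).
Proof.
  intros Hrho Hs0 Sw0.
  pose proof (switch_overlap _ Sw0) as H0.
  induction i as [i IH] using (well_founded_induction Nat.lt_wf_0).
  intros Hi Swi. destruct (Nat.eq_dec i s0) as [->|Hne]; [lia|].
  destruct (switch_recurrence I0 s0 Hrho Hs0 Sw0 i ltac:(lia) Swi)
    as (s & a & Hs & Ei & Ha & Sws & E1 & E2 & E3).
  specialize (IH s ltac:(lia) Hs Sws). lia.
Qed.

End Gaps.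

(** * Limit points of the gap ratios *)

Definition limit_point (sw : nat -> Prop) (r : nat -> R) (y : R) : Prop :=
  forall eps, 0 < eps -> forall K,
  exists i, (K <= i)%nat /\ sw i /\ Rabs (r i - y) < eps.

Section LimitPoints.
Variables (sw : nat -> Prop) (r : nat -> R) (s0 : nat).
Hypothesis r_gt1 : forall i, sw i -> 1 < r i.
Hypothesis r_rec : forall i, (s0 < i)%nat -> sw i ->
  exists s, (s0 <= s)%nat /\ (i <= s + 2)%nat /\ sw s /\
    (r i = quot1 (r s) \/ r i = quot2 (r s)).

Lemma r_lt3 i : (s0 < i)%nat -> sw i -> r i < 3.
Proof.
  intros Hi Hsw. destruct (r_rec i Hi Hsw) as (s & _ & _ & Hs & Hr).
  pose proof (r_gt1 s Hs).
  assert (/ r s < 1) by (rewrite <- Rinv_1; apply Rinv_lt_contravar; lra).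
  unfold quot1, quot2 in Hr. lra.
Qed.

Lemma r_dom i : (s0 + 2 < i)%nat -> sw i -> base_dom (r i).
Proof.
  intros Hi Hsw. destruct (r_rec i ltac:(lia) Hsw) as (s & _ & Hle & Hs & Hr).
  pose proof (r_gt1 s Hs). pose proof (r_lt3 s ltac:(lia) Hs).
  pose proof (Rinv_bounds 1 3 (r s) ltac:(lra) ltac:(lra)).
  unfold quot1, quot2, base_dom in *. lra.
Qed.

Lemma limit_point_dom y : limit_point sw r y -> base_dom y.
Proof.
  intros Hy. split; apply Rnot_lt_le; intros Hlt.
  - destruct (Hy (4 / 3 - y) ltac:(lra) (s0 + 3)%nat) as (i & Hi & Hsw & H).
    apply Rabs_def2 in H. destruct (r_dom i ltac:(lia) Hsw). lra.
  - destruct (Hy (y - 3) ltac:(lra) (s0 + 3)%nat) as (i & Hi & Hsw & H).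
    apply Rabs_def2 in H. destruct (r_dom i ltac:(lia) Hsw). lra.
Qed.

(** Since [r s = 1 / (r i - a)] with denominator at least 1/3 for large [i], inversion is Lipschitz
    with constant 9 there and carries the approximation of [y] to one of [1 / (y - a)]. *)
Lemma limit_point_pull (a y : R) :
  (forall eps, 0 < eps -> forall K,
    exists i s, (K <= i)%nat /\ (i <= s + 2)%nat /\ sw s /\
      Rabs (r i - y) < eps /\ r i = a + / r s) ->
  exists z, limit_point sw r z /\ y = a + / z.
Proof.
  intros H.
  assert (Hinv : forall i s, (s0 + 5 <= i)%nat -> (i <= s + 2)%nat -> sw s ->
            1 / 3 <= / r s).
  { intros i s Hi Hs Hsw. destruct (r_dom s ltac:(lia) Hsw).
    pose proof (Rinv_bounds (4 / 3) 3 (r s) ltac:(lra) ltac:(lra)). lra. }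
  assert (Hy : 1 / 3 <= y - a).
  { apply Rnot_lt_le. intros Hlt.
    destruct (H (1 / 3 - (y - a)) ltac:(lra) (s0 + 5)%nat)
      as (i & s & Hi & Hs & Hsw & Hd & E).
    specialize (Hinv i s Hi Hs Hsw). apply Rabs_def2 in Hd. lra. }
  exists (/ (y - a)). split; [|rewrite Rinv_inv; lra].
  intros eps Heps K.
  destruct (H (eps / 9) ltac:(lra) (s0 + 5 + K + 2)%nat)
    as (i & s & Hi & Hs & Hsw & Hd & E).
  exists s. split; [lia|]. split; [exact Hsw|].
  specialize (Hinv i s ltac:(lia) Hs Hsw).
  replace (r s) with (/ (r i - a))
    by (rewrite E; replace (a + / r s - a) with (/ r s) by ring;
        apply Rinv_inv).
  rewrite Rinv_dist by lra.
  replace (r i - a - (y - a)) with (r i - y) by ring.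
  apply Rle_lt_trans with (9 * Rabs (r i - y)); [|lra].
  apply Rmult_le_compat_r; [apply Rabs_pos|].
  replace 9 with (/ (1 / 3 * (1 / 3))) by field.
  apply Rinv_le_contravar; [lra|].
  apply Rmult_le_compat; lra.
Qed.

(** Pigeonhole on the digit: if digit 1 does not occur arbitrarily late and arbitrarily close to
    [y], then digit 2 does. *)
Lemma limit_point_step y : limit_point sw r y ->
  exists z, limit_point sw r z /\ (y = quot1 z \/ y = quot2 z).
Proof.
  intros Hy.
  destruct (classic (forall eps, 0 < eps -> forall K,
    exists i s, (K <= i)%nat /\ (i <= s + 2)%nat /\ sw s /\
      Rabs (r i - y) < eps /\ r i = 1 + / r s)) as [H1|H1].
  - destruct (limit_point_pull 1 y H1) as (z & Hz & E). exists z. auto.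
  - apply not_all_ex_not in H1 as (e1 & H1).
    apply imply_to_and in H1 as (He1 & H1).
    apply not_all_ex_not in H1 as (K1 & H1).
    destruct (limit_point_pull 2 y) as (z & Hz & E); [|exists z; auto].
    intros eps Heps K.
    destruct (Hy (Rmin eps e1) ltac:(now apply Rmin_pos) (K + K1 + s0 + 1)%nat)
      as (i & Hi & Hsw & Hd).
    pose proof (Rmin_l eps e1). pose proof (Rmin_r eps e1).
    destruct (r_rec i ltac:(lia) Hsw) as (s & Hs & Hle & Hsws & [Hr|Hr]).
    + exfalso. apply H1. exists i, s. repeat split; auto; [lia|lra].
    + exists i, s. repeat split; auto; [lia|lra].
Qed.

End LimitPoints.

Lemma LimSup_len_ratio_ge1 {A : Type} (w : nat -> A) n x :
  pal_lengths w n ->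
  is_LimSup_seq (fun i => INR (n (S (S i))) / INR (n (S i))) (Finite x) ->
  1 <= x.
Proof.
  intros Hn Hl. apply Rnot_lt_le. intros Hlt.
  assert (Hpos : 0 < 1 - x) by lra.
  destruct (Hl (mkposreal _ Hpos)) as [_ (K & HK)].
  specialize (HK K (le_n K)). simpl in HK.
  assert (H1 : 1 <= INR (n (S K)))
    by (apply (le_INR 1); pose proof (n_ge Hn (S K)); lia).
  assert (H2 : INR (n (S K)) <= INR (n (S (S K))))
    by (apply le_INR, (n_le Hn); lia).
  apply (Rmult_lt_compat_r (INR (n (S K)))) in HK; [|lra].
  field_simplify in HK; lra.
Qed.

(** * From the limsup to the limit points *)

Section SmallDelta.
Context {A : Type} {w : nat -> A} {n : nat -> nat} (Hn : pal_lengths w n).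
Variable x : R.
Let u (i : nat) : R := INR (n (S (S i))) / INR (n (S i)).
Hypothesis Hlim : is_LimSup_seq u (Finite x).

Lemma INR_n_S_pos i : INR i + 1 <= INR (n (S i)).
Proof. rewrite <- S_INR. apply le_INR, (n_ge Hn). Qed.

Lemma INR_n_S_ge1 i : 1 <= INR (n (S i)).
Proof. pose proof (INR_n_S_pos i). pose proof (pos_INR i). lra. Qed.

Lemma len_ratio_gap i : u i = 1 + INR (@gap n (S i)) / INR (n (S i)).
Proof.
  unfold u. rewrite (n_S Hn (S i)), plus_INR.
  pose proof (INR_n_S_ge1 i). field. lra.
Qed.

Lemma small_over_n (c eps : R) : 0 <= c -> 0 < eps ->
  exists K, forall i, (K <= i)%nat -> c / INR (n (S i)) < eps.
Proof.
  intros Hc Heps.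
  destruct (nfloor_ex (c / eps)) as (K & HK).
  { apply Rdiv_le_0_compat; lra. }
  exists K. intros i Hi. pose proof (INR_n_S_pos i). apply le_INR in Hi.
  pose proof (INR_n_S_ge1 i).
  apply Rmult_lt_reg_r with (INR (n (S i))); [lra|].
  replace (c / INR (n (S i)) * INR (n (S i))) with (c / eps * eps)
    by (field; lra).
  rewrite (Rmult_comm eps). apply Rmult_lt_compat_r; lra.
Qed.

Lemma delta_eventually_periodic K :
  (forall i, (K <= i)%nat -> ~ @switch n i) -> x = 1.
Proof.
  intros HK. apply Rle_antisym; [|exact (LimSup_len_ratio_ge1 w n x Hn Hlim)].
  assert (Hg : forall i, (K <= i)%nat -> @gap n i = @gap n K).
  { induction 1 as [|i Hi IH]; [reflexivity|].
    rewrite <- IH. apply (not_switch Hn). auto. }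
  apply Rnot_lt_le. intros Hlt.
  assert (Hpos : 0 < (x - 1) / 2) by lra.
  destruct (small_over_n (INR (@gap n K)) _ (pos_INR _) Hpos) as (M & HM).
  destruct (Hlim (mkposreal _ Hpos)) as [H _].
  destruct (H (K + M)%nat) as (i & Hi & Hu). simpl in Hu.
  rewrite len_ratio_gap, Hg in Hu by lia. specialize (HM i ltac:(lia)). lra.
Qed.

Let r (i : nat) : R := INR (@gap n (S i)) / INR (@gap n i).

Lemma INR_gap_ge1 i : 1 <= INR (@gap n i).
Proof. apply (le_INR 1), (gap_pos Hn). Qed.

Lemma switch_ratio_gt1 i : @switch n i -> 1 < r i.
Proof.
  intros Hsw. apply lt_INR in Hsw. pose proof (INR_gap_ge1 i). unfold r.
  apply Rmult_lt_reg_r with (INR (@gap n i)); [lra|].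
  field_simplify; lra.
Qed.

Lemma delta_eventually_small : x < 105 / 61 ->
  exists I0, forall j, (I0 <= j)%nat -> (61 * @gap n j < 44 * n j)%nat.
Proof.
  intros Hx. assert (Hpos : 0 < 105 / 61 - x) by lra.
  destruct (Hlim (mkposreal _ Hpos)) as [_ (K & HK)]. simpl in HK.
  exists (S K). intros [|j] Hj; [lia|]. specialize (HK j ltac:(lia)).
  rewrite len_ratio_gap in HK. pose proof (INR_n_S_ge1 j).
  apply INR_lt. rewrite !mult_INR. simpl (INR 61). simpl (INR 44).
  assert (HK' : INR (@gap n (S j)) / INR (n (S j)) < 44 / 61) by lra.
  apply (Rmult_lt_compat_r (INR (n (S j)))) in HK'; [|lra].
  replace (INR (@gap n (S j)) / INR (n (S j)) * INR (n (S j)))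
    with (INR (@gap n (S j))) in HK' by (field; lra).
  lra.
Qed.

Section ManySwitches.
Hypothesis Hx : x < 105 / 61.
Hypothesis Hinf : forall K, exists i, (K <= i)%nat /\ @switch n i.

(** With consecutive gaps [p] and [q], the constant defect gives [p + q = m + E], so [q / m] differs
    from [q / (p + q)] by at most [E / m]. *)
Lemma switch_ratio_facts : exists s0 E, 0 <= E /\
  (forall i, (s0 < i)%nat -> @switch n i ->
    exists s, (s0 <= s)%nat /\ (i <= s + 2)%nat /\ @switch n s /\
      (r i = quot1 (r s) \/ r i = quot2 (r s))) /\
  (forall i, (s0 <= i)%nat -> @switch n i ->
    r i / (1 + r i) <= u i - 1 <= r i / (1 + r i) + E / INR (n (S i))).
Proof.
  destruct (delta_eventually_small Hx) as (I0 & Hrho).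
  destruct (Hinf (S I0)) as (s0 & Hs0 & Sw0).
  set (E := (@gap n (S s0) + @gap n s0 - n (S s0))%nat).
  exists s0, (INR E). split; [apply pos_INR|]. split.
  - intros i Hi Swi.
    destruct (switch_recurrence Hn I0 s0 Hrho Hs0 Sw0 i Hi Swi)
      as (s & a & Hs & Ei & Ha & Sws & E1 & E2 & _).
    exists s. repeat split; [exact Hs|lia|exact Sws|].
    pose proof (INR_gap_ge1 (S s)). pose proof (INR_gap_ge1 s).
    unfold r, quot1, quot2. rewrite E1, E2, plus_INR, mult_INR.
    destruct Ha as [-> | ->]; [left|right]; simpl; field; lra.
  - intros i Hi Swi. rewrite len_ratio_gap.
    pose proof (switch_defect Hn I0 s0 Hrho Hs0 Sw0 i Hi Swi) as Hd.
    fold E in Hd. apply (f_equal INR) in Hd. rewrite !plus_INR in Hd.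
    pose proof (INR_gap_ge1 i). pose proof (INR_gap_ge1 (S i)).
    pose proof (INR_n_S_ge1 i). assert (HE := pos_INR E).
    unfold r. set (p := INR (@gap n i)) in *.
    set (q := INR (@gap n (S i))) in *. set (m := INR (n (S i))) in *.
    replace (q / p / (1 + q / p)) with (q / (p + q)) by (field; lra).
    replace (p + q) with (m + INR E) by lra.
    replace (1 + q / m - 1) with (q / (m + INR E) +
      q / (m + INR E) * (INR E / m)) by (field; lra).
    assert (H01 : 0 <= q / (m + INR E) <= 1).
    { split; [apply Rdiv_le_0_compat; lra|].
      apply Rmult_le_reg_r with (m + INR E); [lra|].
      field_simplify; lra. }
    assert (0 <= INR E / m) by (apply Rdiv_le_0_compat; lra).
    split; nra.
Qed.

(** The solution of [x = 1 + L / (1 + L)]. *)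
Let L : R := (x - 1) / (2 - x).

Lemma one_plus_L : 1 + L = / (2 - x).
Proof. unfold L. field. lra. Qed.

Lemma limit_point_le_L y : 0 <= y ->
  limit_point (@switch n) r y -> y <= L.
Proof.
  intros Hy0 Hy. destruct switch_ratio_facts as (s0 & E & HE & _ & Hu).
  assert (HG : y / (1 + y) <= x - 1).
  { apply Rnot_lt_le. intros Hlt.
    assert (Hpos : 0 < (y / (1 + y) - (x - 1)) / 2) by lra.
    destruct (Hlim (mkposreal _ Hpos)) as [_ (K & HK)]. simpl in HK.
    destruct (Hy _ Hpos (s0 + K)%nat) as (i & Hi & Swi & Hd).
    specialize (HK i ltac:(lia)). specialize (Hu i ltac:(lia) Swi).
    pose proof (switch_ratio_gt1 i Swi).
    pose proof (ratio_lipschitz (r i) y ltac:(lra) Hy0) as HL.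
    apply Rabs_le_between in HL. lra. }
  replace (y / (1 + y)) with (1 - / (1 + y)) in HG by (field; lra).
  assert (H1 : 2 - x <= / (1 + y)) by lra.
  apply Rinv_le_contravar in H1; [|lra]. rewrite Rinv_inv in H1.
  pose proof one_plus_L. lra.
Qed.

(** Along a run the gap is constant while the length grows, so the length ratio is largest at the
    switch opening the run. Hence the limsup is approached along switches, where the ratio is
    controlled by [r]. *)
Lemma limit_point_L : limit_point (@switch n) r L.
Proof.
  destruct switch_ratio_facts as (s0 & E & HE & Hrec & Hu).
  intros eps Heps K.
  assert (Hpos : 0 < eps / 40) by lra.
  destruct (small_over_n E _ HE Hpos) as (M & HM).
  destruct (Hlim (mkposreal _ Hpos)) as [Hlow (K1 & HK1)]. simpl in *.
  destruct (Hinf (K + M + K1 + s0 + 3)%nat) as (s1 & Hs1 & Sw1).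
  destruct (Hlow s1) as (j & Hj & Huj).
  destruct (last_before _ s1 j Sw1 Hj) as (s & Hs & Sws & Hlast).
  exists s. split; [lia|]. split; [exact Sws|].
  assert (Hus : u j <= u s).
  { rewrite !len_ratio_gap.
    assert (Hg : forall t, (s <= t)%nat -> (t <= j)%nat ->
              @gap n (S t) = @gap n (S s)).
    { induction 1 as [|t Ht IH]; intros Htj; [reflexivity|].
      rewrite <- IH by lia. apply (not_switch Hn), Hlast. lia. }
    rewrite (Hg j) by lia.
    pose proof (INR_n_S_ge1 s).
    assert (INR (n (S s)) <= INR (n (S j))) by (apply le_INR, (n_le Hn); lia).
    apply Rplus_le_compat_l, Rmult_le_compat_l; [apply pos_INR|].
    apply Rinv_le_contravar; lra. }
  specialize (HM s ltac:(lia)). specialize (HK1 s ltac:(lia)).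
  specialize (Hu s ltac:(lia) Sws).
  pose proof (r_dom _ _ s0 switch_ratio_gt1 Hrec s ltac:(lia) Sws) as [Hr1 Hr2].
  set (y := r s) in *. pose proof one_plus_L as HL.
  assert (HL4 : 0 < 1 + L <= 4).
  { rewrite HL. split; [apply Rinv_0_lt_compat; lra|].
    replace 4 with (/ (1 / 4)) by field. apply Rinv_le_contravar; lra. }
  (* Inverts [y / (1 + y)] exactly; the factor [(1 + y) * (1 + L)] is at most 16, as [y <= 3] and
     [2 - x >= 1/4]. *)
  assert (Ediff : y - L = (1 + y) * (1 + L) * (y / (1 + y) - (x - 1))).
  { assert (Ex : x - 1 = 1 - / (1 + L)) by (rewrite HL, Rinv_inv; lra).
    rewrite Ex. field. lra. }
  assert (Hd : Rabs (y / (1 + y) - (x - 1)) <= eps / 20)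
    by (apply Rabs_le; lra).
  rewrite Ediff, Rabs_mult, Rabs_pos_eq by nra.
  assert ((1 + y) * (1 + L) <= 16) by nra.
  pose proof (Rabs_pos (y / (1 + y) - (x - 1))).
  apply Rle_lt_trans with (16 * (eps / 20)); [|lra].
  apply Rmult_le_compat; nra.
Qed.

Lemma delta_many_switches N : x < 1 + lambda N / (1 + lambda N) ->
  exists j, x = 1 + lambda j / (1 + lambda j).
Proof.
  intros HN. pose proof (lambda_dom N) as HdN. pose proof one_plus_L as HL.
  destruct switch_ratio_facts as (s0 & _ & _ & Hrec & _).
  assert (Hdom := limit_point_dom _ _ s0 switch_ratio_gt1 Hrec).
  assert (HLdom := Hdom L limit_point_L).
  destruct (max_is_fixed_point N base_dom quot1 quot2
              (limit_point (@switch n) r) L (lambda N)) as (j & Ej).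
  - exact base_coding.
  - exact Hdom.
  - exact (limit_point_step _ _ s0 switch_ratio_gt1 Hrec).
  - exact limit_point_L.
  - intros y Hy. apply limit_point_le_L; [|exact Hy].
    destruct (Hdom y Hy). lra.
  - exact HdN.
  - apply lambda_fixed.
  - unfold base_dom in *.
    replace (lambda N / (1 + lambda N)) with (1 - / (1 + lambda N)) in HN
      by (field; lra).
    assert (H1 : / (1 + lambda N) < 2 - x) by lra.
    apply Rinv_lt_contravar in H1.
    + rewrite Rinv_inv in H1. lra.
    + apply Rmult_lt_0_compat; [|lra]. apply Rinv_0_lt_compat; lra.
  - exists j. rewrite <- (lambda_unique j L HLdom Ej). unfold base_dom in *.
    replace (L / (1 + L)) with (1 - / (1 + L)) by (field; lra).
    rewrite HL, Rinv_inv. lra.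
Qed.

End ManySwitches.
End SmallDelta.

(** * The bottom of the spectrum *)

Definition sigma_val (k : nat) : R :=
  match k with O => 1 | S k => 1 + lambda k / (1 + lambda k) end.

Lemma sigma_S k : sigma_val (S k) = 2 - / (1 + lambda k).
Proof.
  pose proof (lambda_dom k) as H. unfold base_dom in H. simpl. field. lra.
Qed.

Lemma sigma_increasing k : sigma_val k < sigma_val (S k).
Proof.
  rewrite sigma_S. destruct k as [|k].
  - pose proof (lambda_dom 0) as H. unfold base_dom in H.
    pose proof (Rinv_bounds 2 4 (1 + lambda 0) ltac:(lra) ltac:(lra)).
    simpl sigma_val. lra.
  - rewrite sigma_S. pose proof (lambda_dom k) as H. unfold base_dom in H.
    pose proof (lambda_increasing k).
    assert (/ (1 + lambda (S k)) < / (1 + lambda k)); [|lra].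
    apply Rinv_lt_contravar; nra.
Qed.

Lemma sigma_le i j : (i <= j)%nat -> sigma_val i <= sigma_val j.
Proof.
  induction 1 as [|j _ IH]; [lra|]. pose proof (sigma_increasing j). lra.
Qed.

Lemma sigma_bound k : sigma_val k <= 105 / 61.
Proof.
  apply Rle_trans with (sigma_val (S k)); [apply Rlt_le, sigma_increasing|].
  rewrite sigma_S. pose proof (lambda_dom k) as H. unfold base_dom in H.
  pose proof (lambda_bound k).
  pose proof (Rinv_bounds 1 (61 / 17) (1 + lambda k) ltac:(lra) ltac:(lra)).
  lra.
Qed.

Lemma in_D_below_sigma x k :
  in_D x -> x < sigma_val k -> exists j, x = sigma_val j.
Proof.
  intros (A & w & n & Hn & Hx) Hk.
  assert (Hlim : is_LimSup_seq
            (fun i => INR (n (S (S i))) / INR (n (S i))) (Finite x)).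
  { rewrite <- Hx. exact (proj2_sig (ex_LimSup_seq _)). }
  destruct (classic (forall K, exists i, (K <= i)%nat /\ @switch n i))
    as [Hinf|Hfin].
  - destruct (delta_many_switches Hn x Hlim) with (N := k) as (j & Ej).
    + pose proof (sigma_bound k). lra.
    + exact Hinf.
    + pose proof (sigma_increasing k) as Hs. simpl in Hs. lra.
    + exists (S j). exact Ej.
  - exists 0%nat. apply not_all_ex_not in Hfin as (K & HK).
    apply (delta_eventually_periodic Hn x Hlim K).
    intros i Hi Hsw. apply HK. now exists i.
Qed.

Lemma in_D0_one : in_D0 1.
Proof.
  assert (Hn : pal_lengths (fun _ : nat => tt) (fun i => i)).
  { split; [lia|]. intros k. split; [intros _; now exists k|].
    intros _ j _. reflexivity. }
  exists unit, (fun _ => tt). split.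
  - exists (fun i => i). split; [exact Hn|lia].
  - exists (fun i => i). split; [exact Hn|].
    apply is_LimSup_seq_unique, is_lim_LimSup_seq.
    apply is_lim_seq_ext with (fun i => 1 + / INR (S i)).
    { intros i. rewrite (S_INR (S i)). field. apply not_0_INR. lia. }
    replace (Finite 1) with (Rbar_plus 1 0) by (simpl; f_equal; ring).
    apply is_lim_seq_plus'; [apply is_lim_seq_const|].
    apply (is_lim_seq_incr_1 (fun i => / INR i)).
    apply (is_lim_seq_inv _ p_infty); [apply is_lim_seq_INR|discriminate].
Qed.

(** * Continued fraction expansions and closed forms *)

Lemma cf_fin_ge1 n : forall s, (forall i, 1 <= s i) -> 1 <= cf_fin s n.
Proof.
  induction n as [|n IH]; intros s Hs; simpl; [apply Hs|].
  specialize (IH (fun i => s (S i)) (fun i => Hs (S i))).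
  assert (0 < / cf_fin (fun i => s (S i)) n) by (apply Rinv_0_lt_compat; lra).
  specialize (Hs 0%nat). lra.
Qed.

(** Here [y] lists the complete quotients. Each inversion contracts by at least 3/4, since the
    convergent is at least 1 and the quotient at least 4/3. *)
Lemma cf_fin_dist n : forall s y, (forall i, 1 <= s i) ->
  (forall i, 4 / 3 <= y i) -> (forall i, y i = s i + / y (S i)) ->
  Rabs (cf_fin s n - y 0%nat) <= (3 / 4) ^ n.
Proof.
  induction n as [|n IH]; intros s y Hs Hy E; simpl; rewrite (E 0%nat).
  - pose proof (Rinv_le_contravar (4 / 3) (y 1%nat) ltac:(lra) (Hy 1%nat)).
    assert (0 < / y 1%nat)
      by (apply Rinv_0_lt_compat; specialize (Hy 1%nat); lra).
    apply Rabs_le. lra.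
  - set (s' := fun i => s (S i)).
    specialize (IH s' (fun i => y (S i)) (fun i => Hs (S i)) (fun i => Hy (S i))
                  (fun i => E (S i))).
    simpl in IH. assert (Hc := cf_fin_ge1 n s' (fun i => Hs (S i))).
    specialize (Hy 1%nat).
    replace (s 0%nat + / cf_fin s' n - (s 0%nat + / y 1%nat))
      with (/ cf_fin s' n - / y 1%nat) by ring.
    rewrite Rinv_dist by lra.
    apply Rmult_le_compat; [|apply Rabs_pos| |exact IH].
    + apply Rlt_le, Rinv_0_lt_compat. nra.
    + replace (3 / 4) with (/ (4 / 3)) by field.
      apply Rinv_le_contravar; nra.
Qed.

Lemma cf_value_complete_quotients s y : (forall i, 1 <= s i) ->
  (forall i, 4 / 3 <= y i) -> (forall i, y i = s i + / y (S i)) ->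
  cf_value s (y 0%nat).
Proof.
  intros Hs Hy E. apply is_lim_seq_spec. intros eps.
  destruct (pow_lt_1_zero (3 / 4) ltac:(rewrite Rabs_pos_eq; lra) eps)
    as (N & HN); [apply cond_pos|].
  exists N. intros n Hn. specialize (HN n Hn).
  rewrite Rabs_pos_eq in HN by (apply pow_le; lra).
  pose proof (cf_fin_dist n s y Hs Hy E). lra.
Qed.

(** This accounts for the leading digits 1, 1 of the expansions. *)
Lemma sigma_quot k : sigma_val (S k) = quot1 (quot1 (lambda k)).
Proof.
  pose proof (lambda_dom k) as H. unfold base_dom in H.
  simpl. unfold quot1. field. lra.
Qed.

Lemma quot1_ge y : base_dom y -> 4 / 3 <= quot1 y.
Proof. intros Hy. apply (coding_stab1 _ _ _ base_coding _ Hy). Qed.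

Lemma sigma_2_cf : cf_value cf_sigma2 (sigma_val 2).
Proof.
  set (y := fun i => match i with
                     | O => sigma_val 2 | S O => quot1 (lambda 1)
                     | _ => lambda 1
                     end).
  assert (Hd := lambda_dom 1).
  assert (Hd' := coding_stab1 _ _ _ base_coding _ Hd).
  apply (cf_value_complete_quotients cf_sigma2 y).
  - intros [|[|i]]; simpl; lra.
  - intros [|[|i]]; cbn [y].
    + rewrite sigma_quot. now apply quot1_ge.
    + apply Hd'.
    + apply Hd.
  - intros [|[|i]]; cbn [y cf_sigma2].
    + apply sigma_quot.
    + reflexivity.
    + symmetry. apply (lambda_fixed 1).
Qed.

Lemma sigma_3_cf : cf_value cf_sigma3 (sigma_val 3).
Proof.
  set (y := fun i => match i with
                     | O => sigma_val 3 | S O => quot1 (lambda 2)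
                     | S (S j) => match (j mod 3)%nat with
                                  | O => lambda 2
                                  | S O => quot1 (quot1 (lambda 2))
                                  | _ => quot1 (lambda 2)
                                  end
                     end).
  assert (Hd := lambda_dom 2).
  assert (Hd' := coding_stab1 _ _ _ base_coding _ Hd).
  assert (Hd'' := coding_stab1 _ _ _ base_coding _ Hd').
  apply (cf_value_complete_quotients cf_sigma3 y).
  - intros [|[|i]]; simpl; [lra|lra|]. destruct (Nat.eqb _ 0); lra.
  - intros [|[|i]]; cbn [y].
    + rewrite sigma_quot. now apply quot1_ge.
    + apply Hd'.
    + destruct (i mod 3)%nat as [|[|m]]; [apply Hd|apply Hd''|apply Hd'].
  - intros [|[|i]]; cbn [y cf_sigma3].
    + apply sigma_quot.
    + reflexivity.
    + assert (Hi : (i mod 3 = 0 /\ S i mod 3 = 1 \/ i mod 3 = 1 /\ S i mod 3 = 2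
                \/ i mod 3 = 2 /\ S i mod 3 = 0)%nat).
      { pose proof (Nat.div_mod_eq i 3). pose proof (Nat.div_mod_eq (S i) 3).
        pose proof (Nat.mod_upper_bound i 3).
        pose proof (Nat.mod_upper_bound (S i) 3). lia. }
      destruct Hi as [[-> ->]|[[-> ->]|[-> ->]]]; simpl.
      * symmetry. apply (lambda_fixed 2).
      * reflexivity.
      * reflexivity.
Qed.

Lemma sigma_2 : sigma_val 2 = 1 + sqrt 2 / 2.
Proof.
  rewrite sigma_S, lambda_1. pose proof (sqrt_sqrt 2 ltac:(lra)).
  pose proof (sqrt_pos 2).
  apply Rmult_eq_reg_r with (1 + (1 + sqrt 2)); [|lra].
  field_simplify; [|lra]. nra.
Qed.

Lemma sigma_3 : sigma_val 3 = (2 + sqrt 10) / 3.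
Proof.
  rewrite sigma_S, lambda_2. pose proof (sqrt_sqrt 10 ltac:(lra)).
  pose proof (sqrt_pos 10).
  apply Rmult_eq_reg_r with (1 + (1 + sqrt 10 / 2)); [|lra].
  field_simplify; [|lra]. nra.
Qed.

Lemma sigma_1 : sigma_val 1 = (1 + sqrt 5) / 2.
Proof.
  rewrite <- lambda_0. assert (E := lambda_fixed 0). simpl in E.
  now rewrite sigma_quot, !E.
Qed.

Lemma in_D0_in_D x : in_D0 x -> in_D x.
Proof. intros (A & w & _ & H). now exists A, w. Qed.

Lemma sigma_in_D0 k : in_D0 (sigma_val k).
Proof. destruct k; [apply in_D0_one|apply lambda_realised]. Qed.

(** * Accumulation points of the spectrum *)

Lemma isolated_from_sequence (s : nat -> R) (y : R) (N : nat) :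
  exists eps, 0 < eps /\
  forall j, (j <= N)%nat -> s j <> y -> eps <= Rabs (s j - y).
Proof.
  induction N as [|N (eps & Heps & H)].
  - destruct (Req_dec (s 0%nat) y) as [E|E].
    + exists 1. split; [lra|]. intros j Hj Hne.
      replace j with 0%nat in Hne by lia. contradiction.
    + exists (Rabs (s 0%nat - y)). split; [apply Rabs_pos_lt; lra|].
      intros j Hj _. replace j with 0%nat by lia. lra.
  - destruct (Req_dec (s (S N)) y) as [E|E].
    + exists eps. split; [exact Heps|]. intros j Hj Hne. apply H; [|exact Hne].
      destruct (Nat.eq_dec j (S N)) as [->|]; [contradiction|lia].
    + exists (Rmin eps (Rabs (s (S N) - y))). split.
      { apply Rmin_pos; [exact Heps|apply Rabs_pos_lt; lra]. }
      intros j Hj Hne. destruct (Nat.eq_dec j (S N)) as [->|Hj'].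
      * apply Rmin_r.
      * eapply Rle_trans; [apply Rmin_l|]. apply H; [lia|exact Hne].
Qed.

Section Spectrum.
(** Any set between the two spectra is allowed, so that both are treated at once. *)
Variables (D' : R -> Prop) (sigma_inf : R).
Hypothesis D'_sub : forall x, D' x -> in_D x.
Hypothesis D'_sup : forall x, in_D0 x -> D' x.
Hypothesis sigma_lim : is_lim_seq sigma_val sigma_inf.

Lemma sigma_lt_inf k : sigma_val k < sigma_inf.
Proof.
  apply Rlt_le_trans with (sigma_val (S k)); [apply sigma_increasing|].
  apply (is_lim_seq_incr_compare sigma_val sigma_inf sigma_lim).
  intros n. apply Rlt_le, sigma_increasing.
Qed.

Lemma sigma_close eps : 0 < eps -> exists k, sigma_inf - eps < sigma_val k.
Proof.
  intros Heps. apply is_lim_seq_spec in sigma_lim.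
  destruct (sigma_lim (mkposreal _ Heps)) as (k & Hk).
  exists k. specialize (Hk k (le_n k)). simpl in Hk. apply Rabs_def2 in Hk. lra.
Qed.

Lemma spectrum_below x :
  (D' x /\ 1 <= x < sigma_inf) <-> exists k, x = sigma_val k.
Proof.
  split.
  - intros (Hx & _ & Hlt).
    destruct (sigma_close (sigma_inf - x) ltac:(lra)) as (k & Hk).
    apply (in_D_below_sigma x k); [auto|lra].
  - intros (k & ->). split; [apply D'_sup, sigma_in_D0|].
    split; [|apply sigma_lt_inf]. apply (sigma_le 0 k). lia.
Qed.

Lemma spectrum_smallest_accumulation :
  smallest_accumulation_point D' sigma_inf.
Proof.
  split.
  - intros eps Heps. destruct (sigma_close eps Heps) as (k & Hk).
    pose proof (sigma_lt_inf k). exists (sigma_val k).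
    split; [apply D'_sup, sigma_in_D0|]. split; [lra|].
    apply Rabs_def1; lra.
  - intros y Hy. apply Rnot_lt_le. intros Hlt.
    destruct (sigma_close (sigma_inf - y) ltac:(lra)) as (N & HN).
    destruct (isolated_from_sequence sigma_val y N) as (eps & Heps & Hiso).
    (* The second bound keeps [x] below [sigma_val N], so [x] is one of finitely many values, all
       kept away from [y] by [eps]. *)
    destruct (Hy (Rmin eps (sigma_val N - y))) as (x & Hx & Hne & Hd).
    { apply Rmin_pos; lra. }
    pose proof (Rmin_l eps (sigma_val N - y)).
    pose proof (Rmin_r eps (sigma_val N - y)).
    assert (HxN : x < sigma_val N) by (apply Rabs_def2 in Hd; lra).
    destruct (in_D_below_sigma x N (D'_sub x Hx) HxN) as (j & ->).
    assert (Hj : (j <= N)%nat).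
    { apply Nat.nlt_ge. intros HNj. apply Nat.lt_le_incl, sigma_le in HNj.
      lra. }
    specialize (Hiso j Hj Hne). lra.
Qed.

End Spectrum.

Theorem theorem1p4 :
  exists (sigma : nat -> R) (sigma_inf : R),
    (forall n, sigma n < sigma (S n)) /\
    sigma 0%nat = 1 /\
    sigma 1%nat = (1 + sqrt 5) / 2 /\
    is_lim_seq sigma sigma_inf /\
    smallest_accumulation_point in_D0 sigma_inf /\
    (forall x, (in_D0 x /\ 1 <= x < sigma_inf) <-> exists n, x = sigma n) /\
    smallest_accumulation_point in_D sigma_inf /\
    (forall x, (in_D x /\ 1 <= x < sigma_inf) <-> exists n, x = sigma n) /\
    sigma 2%nat = 1 + sqrt 2 / 2 /\ cf_value cf_sigma2 (sigma 2%nat) /\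
    sigma 3%nat = (2 + sqrt 10) / 3 /\ cf_value cf_sigma3 (sigma 3%nat).
Proof.
  destruct (ex_finite_lim_seq_incr sigma_val (105 / 61)) as (sigma_inf & Hlim).
  { intros n. apply Rlt_le, sigma_increasing. }
  { apply sigma_bound. }
  exists sigma_val, sigma_inf.
  split; [exact sigma_increasing|].
  split; [reflexivity|].
  split; [exact sigma_1|].
  split; [exact Hlim|].
  split; [apply spectrum_smallest_accumulation; auto using in_D0_in_D|].
  split; [apply spectrum_below; auto using in_D0_in_D|].
  split; [apply spectrum_smallest_accumulation; auto using in_D0_in_D|].
  split; [apply spectrum_below; auto using in_D0_in_D|].
  split; [exact sigma_2|].
  split; [exact sigma_2_cf|].
  split; [exact sigma_3|exact sigma_3_cf].
Qed.
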